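(* Let $N\ge 4$, let $C_N$ be the $N$-cycle with all nodes binary ($d_v=2$ for all $v$), and let $\Bbbk$ be a field. Then the global Markov ideal $I_{\mathrm{gl}(C_N)}\subseteq\Bbbk[p_x : x\in[2]^N]$ is radical and has the prime decomposition $$I_{\mathrm{gl}(C_N)} = I_{C_N}\cap\bigcap_{f\in\mathcal B_4}P_f .$$
   Context: $[m]=\{1,\dots,m\}$. $C_N$ has vertex set $[N]$ and edges $\{i,i+1\}$ (indices mod $N$). For $x\in[2]^N$ and $W\subseteq[N]$ write $x_W=(x_v)_{v\in W}$. Global Markov ideal: $I_{\mathrm{gl}(C_N)}$ is the ideal of $\Bbbk[p_x:x\in[2]^N]$ generated by all binomials $p_{x_Ax_Bx_C}p_{x'_Ax'_Bx_C}-p_{x_Ax'_Bx_C}p_{x'_Ax_Bx_C}$, where $A,B,C$ range over all partitions $[N]=A\cup B\cup C$ into disjoint (possibly empty) sets such that $C$ separates $A$ and $B$ in $C_N$ (every path from a vertex of $A$ to a vertex of $B$ meets $C$), and $x_A,x_A'\in[2]^A$, $x_B,x_B'\in[2]^B$, $x_C\in[2]^C$. Toric ideal: $I_{C_N}$ is the kernel of the ring homomorphism $p_x\mapsto\prod_{W}\theta^W_{x_W}$, the product over all cliques $W$ of $C_N$, with independent indeterminates $\theta^W_y$ ($y\in[2]^W$). For a $\{1,2\}$-string $K$, $\overline K$ denotes the string obtained by exchanging $1\leftrightarrow 2$ in every position. $\mathcal B_4$ is the set of all quartic binomials $f=f^+-f^-$ with $$f^+=p_{ABC}\,p_{A\overline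 B\,\overline C}\,p_{\overline A B\overline C}\,p_{\overline A\,\overline B C},\qquad f^-=p_{AB\overline C}\,p_{A\overline B C}\,p_{\overline A BC}\,p_{\overline A\,\overline B\,\overline C},$$ where the cyclically ordered set $[N]$ is partitioned into three nonempty arcs (sets of cyclically consecutive vertices) $S_1,S_2,S_3$, and $A\in[2]^{S_1}$, $B\in[2]^{S_2}$, $C\in[2]^{S_3}$; $p_{ABC}$ is the variable indexed by the state restricting to $A,B,C$ on $S_1,S_2,S_3$. For $f\in\mathcal B_4$, $P_f$ is the monomial ideal generated by all variables $p_x$ that divide neither $f^+$ nor $f^-$. *)

(* Defs.v *)
From mathcomp Require Import all_boot all_order all_algebra.
From mathcomp Require Import boolp classical_sets.
From mathcomp.multinomials Require Import mpoly.

Set Implicit Arguments.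
Unset Strict Implicit.
Unset Printing Implicit Defensive.

Import GRing.Theory.
Local Open Scope ring_scope.

(* The library's idealr_closed and prime_idealr_closed are stated for boolean
   predicates; a classical set I is turned into one by mem (x \in I is then
   equivalent to I x).  Note that idealr_closed includes 1 \notin I, so that
   prime ideals are proper. *)
Section Ideals.
Variable R : comNzRingType.
Implicit Types (I G : set R).

Definition ideal_gen G : set R :=
  [set f | exists s : seq (R * R),
     (forall cg, cg \in s -> G cg.2) /\ f = \sum_(cg <- s) cg.1 * cg.2]%classic.

Definition is_prime_ideal I : Prop :=
  idealr_closed (mem I) /\ prime_idealr_closed (mem I).

Definition is_radical I : Prop := forall (f : R) (n : nat), I (f ^+ n) -> I f.

Definition divides (g f : R) : Prop := exists q : R, f = q * g.

End Ideals.

(* Polynomials whose indeterminates are indexed by a finite type T. *)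
Notation mpoly_on k T := {mpoly k[#|{: T}|]}.

Definition indet (k : fieldType) (T : finType) (t : T) : mpoly_on k T :=
  'X_(enum_rank t).

(* Vertices are 0, ..., N - 1, and ordS is the cyclic successor. *)
Section Cycle.
Variable N : nat.
Implicit Types (A B C W : {set 'I_N}).

Definition cycle_adj : rel 'I_N := [rel u v | (ordS u == v) || (ordS v == u)].

Definition is_clique W : bool :=
  [forall u in W, forall v in W, (u != v) ==> cycle_adj u v].

Definition is_partition3 A B C : Prop :=
  [/\ A :|: B :|: C = [set: 'I_N]%SET,
      [disjoint A & B], [disjoint A & C] & [disjoint B & C]].

Definition separates C A B : Prop :=
  forall (u : 'I_N) (s : seq 'I_N),
    u \in A -> path cycle_adj u s -> uniq (u :: s) -> last u s \in B ->
    has (mem C) (u :: s).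

Definition is_arc W : Prop :=
  exists (u : 'I_N) (l : nat), W = [set v in traject (@ordS N) u l]%SET.

End Cycle.

(* The two values 1, 2 of a node are encoded as booleans, so that exchanging
   1 and 2 is negation. *)
Definition state (N : nat) := {ffun 'I_N -> bool}.

Section States.
Variable N : nat.

Definition restr (W : {set 'I_N}) (x : state N) :
    {ffun {v : 'I_N | v \in W} -> bool} := [ffun v => x (val v)].

(* A partial state on A is represented by any total state that restricts to
   it: glue A B a b c is the total state x_A x_B x_C with x_A = restr A a,
   x_B = restr B b and x_C = restr C c, for a partition A, B, C. *)
Definition glue (A B : {set 'I_N}) (a b c : state N) : state N :=
  [ffun v => if v \in A then a v else if v \in B then b v else c v].

Definition flip (x : state N) : state N := [ffun v => ~~ x v].

End States.

Section MarkovIdeals.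
Variables (k : fieldType) (N : nat).

Notation R := (mpoly_on k (state N)).
Notation p := (@indet k (state N)).

Definition global_markov_binomials : set R :=
  [set f | exists A B C : {set 'I_N},
     [/\ is_partition3 A B C, separates C A B &
         exists a a' b b' c : state N,
           f = p (glue A B a b c) * p (glue A B a' b' c)
             - p (glue A B a b' c) * p (glue A B a' b c)]]%classic.

Definition global_markov_ideal : set R := ideal_gen global_markov_binomials.

Definition clique := {W : {set 'I_N} | is_clique W}.

(* Indices of the indeterminates theta^W_y. *)
Definition param := {W : clique & {ffun {v : 'I_N | v \in val W} -> bool}}.

Definition toric_param (x : state N) : mpoly_on k param :=
  \prod_(W : clique)
    @indet k param (existT _ W (restr (val W) x)).

Definition toric_map : R -> mpoly_on k param :=
  mmap (@mpolyC _ k) (fun i => toric_param (enum_val i)).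

Definition toric_ideal : set R := [set f | toric_map f = 0]%classic.

(* The elements of B_4, as pairs (f^+, f^-). *)
Definition B4 : set (R * R) :=
  [set f | exists S1 S2 S3 : {set 'I_N},
     [/\ is_partition3 S1 S2 S3,
         [/\ is_arc S1, is_arc S2 & is_arc S3],
         [/\ S1 != finset.set0, S2 != finset.set0 & S3 != finset.set0] &
         exists a b c : state N,
           let q x y z := p (glue S1 S2 x y z) in
           f = (q a b c * q a (flip b) (flip c)
                * q (flip a) b (flip c) * q (flip a) (flip b) c,
                q a b (flip c) * q a (flip b) c
                * q (flip a) b c * q (flip a) (flip b) (flip c))]]%classic.

Definition monomial_prime (f : R * R) : set R :=
  ideal_gen [set g | exists x : state N,
     [/\ g = p x, ~ divides (p x) f.1 & ~ divides (p x) f.2]]%classic.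

End MarkovIdeals.

Arguments global_markov_ideal k N : clear implicits.
Arguments toric_ideal k N : clear implicits.
Arguments B4 k N : clear implicits.

(* Main.v *)
(** A monomial is a multiset of rows (states), and a quadratic generator of the
global Markov ideal exchanges between two rows that agree at two vertices the
segment between these vertices.  Two monomials have the same image under the
toric map iff their edge counts agree.  Call an edge flat in a monomial if all
rows have the same sum of the two bits on it.  The rows of a monomial all lie
among the eight states of some f in B_4 exactly when at most three edges are
nonflat, so a polynomial in all the P_f only contains monomials with at least
four nonflat edges.  The point is that a fibre of the toric map with at least
four nonflat edges is connected under exchanges.  Cut the cycle at vertex 0 and
group the rows by their bit there; up to exchanges inside a group a monomial is
given by the edge counts of the two groups, i.e. by two flows on a layered
graph.  Swaps between the groups first make the node counts agree with those of
the target; the remaining differences are corrected, one edge at a time, by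
quartic moves, each of which is a composition of exchanges unless at most three
edges are nonflat. *)

Require Import Defs.
From mathcomp Require Import all_boot all_order all_algebra.
From mathcomp Require Import boolp classical_sets.
From mathcomp.multinomials Require Import mpoly.
From mathcomp Require Import zify.

Set Implicit Arguments.
Unset Strict Implicit.
Unset Printing Implicit Defensive.

(** * Rows, exchanges of segments, and groups of rows with equal bit at 0 *)

Section Rows.
Variable n : nat.
Local Notation N := n.+1.
Implicit Types (x y r s : state N) (u v w : seq (state N)).

(* Positions are read modulo N, so that position N is position 0 again. *)
Definition bit x (i : nat) : bool := x (inord (i %% N)).

Definition mkrow (f : nat -> bool) : state N := [ffun v => f (val v)].

Lemma bitN x : bit x N = bit x 0.
Proof. by rewrite /bit modnn mod0n. Qed.

Lemma bit_ord x (v : 'I_N) : bit x v = x v.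
Proof. by rewrite /bit modn_small ?ltn_ord // inord_val. Qed.

Lemma bit_mkrow f i : i < N -> bit (mkrow f) i = f i.
Proof. by move=> lt_i; rewrite /bit ffunE modn_small //= inordK. Qed.

Lemma eq_bit x y : (forall i, i < N -> bit x i = bit y i) -> x = y.
Proof. by move=> eq_xy; apply/ffunP => v; rewrite -!bit_ord eq_xy. Qed.

(** The interval is open, and k = N stands for the vertex 0. The bit at 0 is never altered, so every
    row stays in its group. *)
Definition swap i k x y : state N :=
  mkrow (fun m => if i < m < k then bit y m else bit x m).

Lemma bit_swap i k x y m : m <= N -> k <= N ->
  bit (swap i k x y) m = if i < m < k then bit y m else bit x m.
Proof.
move=> le_m le_k; have [->|neq_m] := eqVneq m N.
  by rewrite bitN bit_mkrow //= !bitN [N < k]ltnNge le_k andbF.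
by rewrite bit_mkrow // ltn_neqAle neq_m.
Qed.

Inductive conn : seq (state N) -> seq (state N) -> Prop :=
| conn_perm u v of perm_eq u v : conn u v
| conn_swap i k x y u of i < k & k <= N & bit x i = bit y i & bit x k = bit y k :
    conn [:: x, y & u] [:: swap i k x y, swap i k y x & u]
| conn_trans u v w of conn u v & conn v w : conn u w.

Lemma conn_refl u : conn u u.
Proof. exact: conn_perm. Qed.

Lemma conn_cons x u v : conn u v -> conn (x :: u) (x :: v).
Proof.
elim=> {u v}[u v eq_uv|i k y z u lt_ik le_k eq_i eq_k|u v w _ uv _ vw].
- by apply: conn_perm; rewrite perm_cons.
- have perm3 (a b : state N) :
    perm_eq [:: x, a, b & u] [:: a, b, x & u] /\
    perm_eq [:: a, b, x & u] [:: x, a, b & u].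
    suff P : perm_eq [:: x, a, b & u] [:: a, b, x & u] by split; rewrite // perm_sym.
    by apply/permP => p /=; lia.
  apply: conn_trans (conn_perm (proj1 (perm3 _ _))) _.
  apply: conn_trans (conn_perm (proj2 (perm3 _ _))).
  exact: conn_swap.
- exact: conn_trans vw.
Qed.

Definition tri (g : bool) l (a b : bool) x :=
  [&& bit x 0 == g, bit x l == a & bit x l.+1 == b].

Definition cnt u g l a b := count (tri g l a b) u.

(** Finer than equality of edge counts: the two groups are counted separately. *)
Definition Teq u v := forall g l a b, l < N -> cnt u g l a b = cnt v g l a b.

Lemma perm_Teq u v : perm_eq u v -> Teq u v.
Proof. by move=> /permP eq_uv g l a b _; apply: eq_uv. Qed.

Lemma Teq_trans v u w : Teq u v -> Teq v w -> Teq u w.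
Proof. by move=> uv vw g l a b lt_l; rewrite uv ?vw. Qed.

Lemma cnt_gt0 u x l : x \in u -> 0 < cnt u (bit x 0) l (bit x l) (bit x l.+1).
Proof. by move=> xu; rewrite -has_count; apply/hasP; exists x; rewrite // /tri !eqxx. Qed.

Lemma cnt_row u g l a b : 0 < cnt u g l a b ->
  exists x, [/\ x \in u, bit x 0 = g, bit x l = a & bit x l.+1 = b].
Proof. by rewrite -has_count => /hasP[x xu /and3P[/eqP ? /eqP ? /eqP ?]]; exists x. Qed.

Lemma perm_pick2 x y u : x \in u -> y \in u -> x <> y ->
  perm_eq u [:: x, y & rem y (rem x u)].
Proof.
move=> xu yu neq_xy; apply: perm_trans (perm_to_rem xu) _; rewrite perm_cons.
have := yu; rewrite (perm_mem (perm_to_rem xu)) inE => /orP[/eqP/esym //|].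
exact: perm_to_rem.
Qed.

(** For rows of the same group the end point N imposes no condition, since it is the vertex 0. *)
Definition tail j x y := swap j N x y.

Lemma bit_tail j x y m : bit x 0 = bit y 0 -> m <= N ->
  bit (tail j x y) m = if j < m then bit y m else bit x m.
Proof.
move=> eq0 le_m; rewrite bit_swap //; have [->|neq_m] := eqVneq m N.
  by rewrite ltnn andbF !bitN eq0 if_same.
by rewrite [m < N]ltn_neqAle neq_m le_m !andbT.
Qed.

Lemma tri_tail j x y g l a b : bit x 0 = bit y 0 -> bit x j = bit y j -> l < N ->
  tri g l a b (tail j x y) = tri g l a b (if j <= l then y else x).
Proof.
move=> eq0 eqj lt_l; rewrite /tri !bit_tail ?(ltnW lt_l) //= ltnS.
have [le_jl|lt_lj] := leqP j l; last by rewrite (ltnNge j l) (ltnW lt_lj).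
case: ltnP => [_|le_lj]; first by rewrite eq0.
have -> : l = j by lia.
by rewrite eq0 eqj.
Qed.

Lemma Teq_tail j x y u : bit x 0 = bit y 0 -> bit x j = bit y j ->
  Teq [:: x, y & u] [:: tail j x y, tail j y x & u].
Proof.
move=> eq0 eqj g l a b lt_l; rewrite /cnt /= !tri_tail //.
by case: ifP => _; lia.
Qed.

Lemma conn_tail j x y u : j < N -> bit x 0 = bit y 0 -> bit x j = bit y j ->
  conn [:: x, y & u] [:: tail j x y, tail j y x & u].
Proof. by move=> lt_j eq0 eqj; apply: conn_swap; rewrite // !bitN. Qed.

(* The row is assembled edge by edge: two rows of the group [bit _ 0 = g] that
   agree at a position can exchange their tails there. *)
Lemma conn_path u g (p : nat -> bool) i k : i < k <= N ->
    (forall m, i <= m < k -> 0 < cnt u g m (p m) (p m.+1)) ->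
  exists u', [/\ conn u u', Teq u u',
    forall y, y \in u -> bit y 0 != g -> y \in u' &
    exists2 x, x \in u' & bit x 0 = g /\ forall m, i <= m <= k -> bit x m = p m].
Proof.
elim: k => [|k IHk]; first by rewrite ltn0.
rewrite ltnS => /andP[le_ik lt_kN] posp.
move: le_ik; rewrite leq_eqVlt => /orP[/eqP eq_ik|lt_ik].
  have /cnt_row[x [xu x0 xi xi1]] : 0 < cnt u g k (p k) (p k.+1) by apply: posp; lia.
  exists u; split=> //; first exact: conn_refl.
  exists x => //; split=> // m; rewrite leq_eqVlt => /andP[/orP[/eqP <-|lt_im]].
    by rewrite eq_ik.
  by move=> le_mk; have -> : m = k.+1 by lia.
have [||u' [uu' Tuu' keep [x xu' [x0 xp]]]] := IHk; first by lia.
  by move=> m Hm; apply: posp; lia.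
have /cnt_row[y [yu' y0 yk yk1]] : 0 < cnt u' g k (p k) (p k.+1).
  by rewrite -Tuu' //; apply: posp; lia.
(* The row built so far may itself carry the next edge; otherwise it takes over the tail of [y] at
   k. *)
have [eq_xy|/eqP neq_xy] := eqVneq x y.
  exists u'; split=> //; exists x => //; split=> // m /andP[le_im].
  by rewrite leq_eqVlt => /orP[/eqP->|lt_mk]; [rewrite eq_xy|apply: xp; rewrite le_im].
have perm_u' := perm_pick2 xu' yu' neq_xy; set w := rem _ _ in perm_u'.
have eq0 : bit x 0 = bit y 0 by rewrite x0 y0.
have eqk : bit x k = bit y k by rewrite yk xp // leqnn ltnW.
exists [:: tail k x y, tail k y x & w]; split.
- apply: (conn_trans uu'); apply: conn_trans (conn_perm perm_u') _.
  exact: conn_tail.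
- apply: Teq_trans Tuu' _; apply: Teq_trans (perm_Teq perm_u') _.
  exact: Teq_tail.
- move=> z zu z0; have := keep z zu z0; rewrite (perm_mem perm_u') !inE.
  by case/or3P => [/eqP ez|/eqP ez|->]; rewrite ?orbT //; move: z0; rewrite ez ?x0 ?y0 eqxx.
exists (tail k x y); first by rewrite inE eqxx.
split=> [|m /andP[le_im le_mk]]; first by rewrite bit_tail.
rewrite bit_tail ?(leq_trans le_mk) //; case: ltnP => [lt_km|le_mk']; last by apply: xp; rewrite le_im.
by have -> : m = k.+1 by apply/eqP; rewrite eqn_leq le_mk.
Qed.

(** Each row of [u] can be assembled in [v] along all N edges, because the counts it uses are
    positive. It is then removed from both sides. *)
Lemma Teq_conn v u : Teq v u -> conn v u.
Proof.
elim: u v => [|x u IHu] v Tvu.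
  case: v Tvu => [_|y v /(_ (bit y 0) 0 (bit y 0) (bit y 1) isT)]; first exact: conn_refl.
  by move: (cnt_gt0 0 (mem_head y v)) => /[swap] ->.
have [||v' [vv' Tvv' _ [y yv' [y0 yx]]]] := @conn_path v (bit x 0) (bit x) 0 N.
- by rewrite ltn0Sn leqnn.
- by move=> m /andP[_ lt_m]; rewrite Tvu // cnt_gt0 ?mem_head.
have eq_yx : y = x by apply: eq_bit => i lt_i; apply: yx; lia.
rewrite {}eq_yx in yv'.
have perm_v' := perm_to_rem yv'.
apply: (conn_trans vv'); apply: conn_trans (conn_perm perm_v') _; apply: conn_cons.
apply: IHu => g l a b lt_l; apply/eqP; rewrite -(eqn_add2l (tri g l a b x)).
by apply/eqP; rewrite -[LHS](perm_Teq perm_v' g a b lt_l) -Tvv' // Tvu.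
Qed.

End Rows.

(** * Rearrangements of sequences *)

Lemma uniq_sub_perm (T : eqType) (l u : seq T) :
  uniq l -> {subset l <= u} -> exists w, perm_eq u (l ++ w).
Proof.
elim: l u => [|x l IHl] u /=; first by exists u.
move=> /andP[xl uniq_l] sub_u; have xu := sub_u x (mem_head x l).
have [|y yl|w perm_w] := IHl (rem x u) => //.
  have := sub_u y; rewrite inE yl orbT => /(_ isT).
  rewrite (perm_mem (perm_to_rem xu)) inE => /orP[/eqP eq_yx|//].
  by rewrite -eq_yx yl in xl.
by exists w; apply: perm_trans (perm_to_rem xu) _; rewrite /= perm_cons.
Qed.

Lemma perm_1324 (T : eqType) (a b c d : T) w :
  perm_eq [:: a, b, c, d & w] [:: a, c, b, d & w].
Proof. by apply/permP => q /=; rewrite !addnA (addnAC (q a)). Qed.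

Lemma perm_3142 (T : eqType) (a b c d : T) w :
  perm_eq [:: a, b, c, d & w] [:: b, d, a, c & w].
Proof. by apply/permP => q /=; rewrite !addnA; congr addn; lia. Qed.

(** * Quartic moves as double exchanges of tails *)

Section Quartic.
Variable n : nat.
Local Notation N := n.+1.
Implicit Types (x y r s : state N) (u v w : seq (state N)).

(* A quartic move across the edge (j, j + 1) replaces four rows whose bits at 0,
   j and j + 1 have parity p by four rows of the opposite parity. *)
Definition quad u j p := forall g a, 0 < cnt u g j a (p (+) g (+) a).

(** The correction terms stand on both sides to avoid truncated subtraction: at edge j the four
    cells of parity p lose one row each and the four others gain one. *)
Definition kstep u v j p := forall g l a b, l < N ->
  (cnt u g l a b + ((l == j) && (b != p (+) g (+) a)) =
   cnt v g l a b + ((l == j) && (b == p (+) g (+) a)))%N.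

Definition can_kstep u j p := exists2 v, conn u v & kstep u v j p.

Lemma Teq_quad u v j p : j < N -> Teq u v -> quad u j p -> quad v j p.
Proof. by move=> lt_j Tuv qu g a; rewrite -Tuv. Qed.

Lemma can_kstep_conn u v j p : conn u v -> Teq u v -> can_kstep v j p -> can_kstep u j p.
Proof.
move=> uv Tuv [w vw Kvw]; exists w; first exact: conn_trans vw.
by move=> g l a b lt_l; rewrite Tuv ?Kvw.
Qed.

Lemma tri_tail_neq j x y g l a b : bit x 0 = bit y 0 -> l < N ->
  tri g l a b (tail j x y) =
  [&& bit x 0 == g, bit (if j < l then y else x) l == a
    & bit (if j <= l then y else x) l.+1 == b].
Proof.
by move=> eq0 lt_l; rewrite /tri !bit_tail ?(ltnW lt_l) //= ltnS; do 2!case: ifP.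
Qed.

(** In each group the two rows have opposite bits at j and the same parity p, so exchanging their
    tails pairs every bit at j with the opposite bit at j + 1. This only compares counts: the rows
    differ at j, so the exchange of tails is not itself a swap. *)
Lemma kstep_tails j p r r2 s s2 w :
    bit r2 0 = bit r 0 -> bit s2 0 = bit s 0 -> bit s 0 = ~~ bit r 0 ->
    bit r2 j = ~~ bit r j -> bit s2 j = ~~ bit s j ->
    bit r j.+1 = p (+) bit r 0 (+) bit r j ->
    bit r2 j.+1 = p (+) bit r2 0 (+) bit r2 j ->
    bit s j.+1 = p (+) bit s 0 (+) bit s j ->
    bit s2 j.+1 = p (+) bit s2 0 (+) bit s2 j ->
  kstep [:: r, r2, s, s2 & w]
    [:: tail j r r2, tail j r2 r, tail j s s2, tail j s2 s & w] j p.
Proof.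
move=> r20 s20 s0 r2j s2j r1 r21 s1 s21 g l a b lt_l.
rewrite /cnt /= !tri_tail_neq // /tri.
have [lt_lj|lt_jl|->] := ltngtP l j; rewrite /= ?andbF ?addn0.
- by [].
- rewrite r20 s20 addnCA; congr (_ + (_ + _))%N; exact: addnCA.
rewrite {}r1 {}r21 {}s1 {}s21 {}r20 {}s20 {}s0 {}r2j {}s2j.
set c := count _ _; move: c => c.
move: (bit r 0) (bit r j) (bit s j) p g a b => r0 rj sj p g a b.
by case: r0; case: rj; case: sj; case: p; case: g; case: a; case: b; rewrite /= ?addn0 ?add0n ?addn1 ?add1n.
Qed.

Lemma conn_swap_at i k x y u v v' : i < k <= N -> bit x i = bit y i -> bit x k = bit y k ->
  perm_eq v [:: x, y & u] -> perm_eq v' [:: swap i k x y, swap i k y x & u] ->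
  conn v v'.
Proof.
move=> /andP[lt_ik le_k] eq_i eq_k perm_v perm_v'.
apply: conn_trans (conn_perm perm_v) _.
by apply: conn_trans (conn_swap u lt_ik le_k eq_i eq_k) _; apply: conn_perm; rewrite perm_sym.
Qed.

(* Swap (m, j + 1) between r and s, exchange tails with r2 and s2 at j, and swap
   (m, j + 1) back between the new rows. *)
Lemma conn_tails_left m j r r2 s s2 w : m < j -> j < N ->
    bit r m = bit s m -> bit r j.+1 = bit s j.+1 ->
    bit r2 j.+1 = bit s2 j.+1 -> bit r2 j = bit s j -> bit s2 j = bit r j ->
    bit r2 0 = bit r 0 -> bit s2 0 = bit s 0 ->
  conn [:: r, r2, s, s2 & w] [:: tail j r r2, tail j r2 r, tail j s s2, tail j s2 s & w].
Proof.
move=> lt_mj lt_j eqm eq1 eq21 r2j s2j r20 s20.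
set R := swap m j.+1 r s; set S := swap m j.+1 s r.
have bR i : i <= N -> bit R i = if m < i <= j then bit s i else bit r i.
  by move=> le_i; rewrite bit_swap.
have bS i : i <= N -> bit S i = if m < i <= j then bit r i else bit s i.
  by move=> le_i; rewrite bit_swap.
apply: (@conn_trans _ _ [:: R, r2, S, s2 & w]).
  by apply: (@conn_swap_at m j.+1 r s [:: r2, s2 & w]);
    rewrite ?ltnS ?(ltnW lt_mj) //; exact: perm_1324.
have R0 : bit R 0 = bit r2 0 by rewrite bR.
have S0 : bit S 0 = bit s2 0 by rewrite bS.
have Rj : bit R j = bit r2 j by rewrite bR ?(ltnW lt_j) // lt_mj leqnn r2j.
have Sj : bit S j = bit s2 j by rewrite bS ?(ltnW lt_j) // lt_mj leqnn s2j.
apply: (@conn_trans _ _ [:: tail j R r2, tail j r2 R, S, s2 & w]).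
  exact: conn_tail.
apply: (@conn_trans _ _ [:: tail j R r2, tail j r2 R, tail j S s2, tail j s2 S & w]).
  by do 2!apply: conn_cons; apply: conn_tail.
have -> : tail j r2 r = tail j r2 R.
  apply: eq_bit => i lt_i; rewrite !bit_tail ?(ltnW lt_i) //.
  by case: ifP => // lt_ji; rewrite bR ?(ltnW lt_i) // [i <= j]leqNgt lt_ji andbF.
have -> : tail j s2 s = tail j s2 S.
  apply: eq_bit => i lt_i; rewrite !bit_tail ?(ltnW lt_i) //.
  by case: ifP => // lt_ji; rewrite bS ?(ltnW lt_i) // [i <= j]leqNgt lt_ji andbF.
apply: (@conn_swap_at m j.+1 (tail j R r2) (tail j S s2) [:: tail j r2 R, tail j s2 S & w]).
- by rewrite ltnS (ltnW lt_mj).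
- by have le_m := ltnW (ltn_trans lt_mj lt_j); rewrite !bit_tail ?bR ?bS // ltnn (ltnNge j m) (ltnW lt_mj).
- by rewrite !bit_tail // ltnSn.
- exact: perm_1324.
have -> : swap m j.+1 (tail j R r2) (tail j S s2) = tail j r r2.
  apply: eq_bit => i lt_i; have le_i := ltnW lt_i.
  rewrite bit_swap // !bit_tail // bR // bS // ltnS.
  case: (leqP i j) => ij; rewrite ?andbT ?andbF //.
  by case: ifP => // ->.
have -> : swap m j.+1 (tail j S s2) (tail j R r2) = tail j s s2.
  apply: eq_bit => i lt_i; have le_i := ltnW lt_i.
  rewrite bit_swap // !bit_tail // bR // bS // ltnS.
  case: (leqP i j) => ij; rewrite ?andbT ?andbF //.
  by case: ifP => // ->.
exact: perm_1324.
Qed.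

(** The mirror image of [conn_tails_left]: swapping (j, m) between [r] and [s] makes them agree at j
    + 1 with [r2] and [s2], so tails can be exchanged there; then (j, m) is swapped back. *)
Lemma conn_tails_right m j r r2 s s2 w : j.+1 < m -> m <= N ->
    bit r m = bit s m -> bit r j = bit s j ->
    bit r2 j = bit s2 j -> bit r2 j.+1 = bit s j.+1 -> bit s2 j.+1 = bit r j.+1 ->
    bit r2 0 = bit r 0 -> bit s2 0 = bit s 0 ->
  conn [:: r, r2, s, s2 & w] [:: tail j r r2, tail j r2 r, tail j s s2, tail j s2 s & w].
Proof.
move=> lt_jm le_m eqm eqj eq2j r21 s21 r20 s20.
have lt_j : j.+1 < N by apply: leq_trans le_m.
set R := swap j m r s; set S := swap j m s r.
have bR i : i <= N -> bit R i = if j < i < m then bit s i else bit r i.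
  by move=> le_i; rewrite bit_swap.
have bS i : i <= N -> bit S i = if j < i < m then bit r i else bit s i.
  by move=> le_i; rewrite bit_swap.
apply: (@conn_trans _ _ [:: R, r2, S, s2 & w]).
  apply: (@conn_swap_at j m r s [:: r2, s2 & w]) => //; last 2 first.
  - exact: perm_1324.
  - exact: perm_1324.
  by rewrite le_m (ltn_trans _ lt_jm).
have R0 : bit R 0 = bit r2 0 by rewrite bR.
have S0 : bit S 0 = bit s2 0 by rewrite bS.
have Rj : bit R j.+1 = bit r2 j.+1 by rewrite bR ?(ltnW lt_j) // ltnSn lt_jm r21.
have Sj : bit S j.+1 = bit s2 j.+1 by rewrite bS ?(ltnW lt_j) // ltnSn lt_jm s21.
apply: (@conn_trans _ _ [:: tail j.+1 R r2, tail j.+1 r2 R, S, s2 & w]).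
  exact: conn_tail.
apply: (@conn_trans _ _ [:: tail j.+1 R r2, tail j.+1 r2 R, tail j.+1 S s2, tail j.+1 s2 S & w]).
  by do 2!apply: conn_cons; apply: conn_tail.
have -> : tail j r r2 = tail j.+1 R r2.
  apply: eq_bit => i lt_i; have le_i := ltnW lt_i; rewrite !bit_tail // bR //.
  by case: (ltngtP i j.+1) => // ->; rewrite lt_jm.
have -> : tail j s s2 = tail j.+1 S s2.
  apply: eq_bit => i lt_i; have le_i := ltnW lt_i; rewrite !bit_tail // bS //.
  by case: (ltngtP i j.+1) => // ->; rewrite lt_jm.
(* The altered segments now lie in the rows that begin like [r2] and [s2], so the swap is undone
   between these two. *)
set Y := tail j.+1 r2 R; set Y' := tail j.+1 s2 S.
apply: (@conn_swap_at j m Y Y' [:: tail j.+1 R r2, tail j.+1 S s2 & w]).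
- by rewrite le_m (ltn_trans _ lt_jm).
- by rewrite !bit_tail ?(ltnNge _ j) ?leqnSn // ltnW // ltnW.
- by rewrite !bit_tail // lt_jm bR ?bS // ltnn andbF.
- exact: perm_3142.
have -> : swap j m Y Y' = tail j r2 r.
  apply: eq_bit => i lt_i; have le_i := ltnW lt_i.
  rewrite bit_swap // !bit_tail // bR // bS //.
  case: (ltngtP i j.+1) => //= [lt_1i|->]; last by rewrite lt_jm.
  by case: (i < m).
have -> : swap j m Y' Y = tail j s2 s.
  apply: eq_bit => i lt_i; have le_i := ltnW lt_i.
  rewrite bit_swap // !bit_tail // bR // bS //.
  case: (ltngtP i j.+1) => //= [lt_1i|->]; last by rewrite lt_jm.
  by case: (i < m).
exact: perm_3142.
Qed.

End Quartic.

(** * Bits tied to one another on all rows *)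

Lemma addbK3 p g a : p (+) g (+) (p (+) g (+) a) = a.
Proof. by rewrite addbA addbb. Qed.

Definition tied (T : eqType) (u : seq T) (e f : T -> bool) :=
  exists c, {in u, forall x, f x = e x (+) c}.

(** On rows, f is a function of the pair (z, e) that takes opposite values at opposite corners of
    the square. The only such functions are z, e and their negations. *)
Lemma blocked_tied (T : eqType) (u : seq T) (z e f : T -> bool) :
    (forall g a, exists2 x, x \in u & z x = g /\ e x = a) ->
    {in u &, forall r s, z r != z s -> e r != e s -> f r != f s} ->
  tied u z f \/ tied u e f.
Proof.
move=> ex bl.
have [x00 u00 [z00 e00]] := ex false false; have [x01 u01 [z01 e01]] := ex false true.
have [x10 u10 [z10 e10]] := ex true false; have [x11 u11 [z11 e11]] := ex true true.
have := bl _ _ u00 u11; have := bl _ _ u01 u10.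
rewrite z00 z01 z10 z11 e00 e01 e10 e11 => /(_ isT isT) b1 /(_ isT isT) b2.
(* Every row is compared with the chosen row at the opposite corner. *)
have bx x : x \in u -> f x = if z x then (if e x then ~~ f x00 else ~~ f x01)
                             else (if e x then ~~ f x10 else ~~ f x11).
  move=> xu; move: (bl _ _ xu u00) (bl _ _ xu u01) (bl _ _ xu u10) (bl _ _ xu u11).
  rewrite z00 z01 z10 z11 e00 e01 e10 e11; case: (z x) (e x) => [] [] /=.
  - by move=> /(_ isT isT); case: (f x) (f x00) => [] [].
  - by move=> _ /(_ isT isT); case: (f x) (f x01) => [] [].
  - by move=> _ _ /(_ isT isT); case: (f x) (f x10) => [] [].
  - by move=> _ _ _ /(_ isT isT); case: (f x) (f x11) => [] [].
have [eq_f|neq_f] := eqVneq (f x00) (f x01); [left|right]; exists (f x00) => x /bx ->;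
  move: b1 b2; first rewrite eq_f; try (move: neq_f; case: (f x00));
  by case: (f x01) (f x10) (f x11) (z x) (e x) => [] [] [] [] [].
Qed.

Lemma tied_flat (T : eqType) (u : seq T) (e f f' : T -> bool) :
  tied u e f -> tied u e f' -> exists c, {in u, forall x, f x (+) f' x = c}.
Proof.
move=> [c fc] [c' fc']; exists (c (+) c') => x xu.
by rewrite fc ?fc' // addbACA addbb addFb.
Qed.

(** The last hypothesis forces the positions to split into an initial stretch tied to position 0 and
    a final one tied to q. Neighbours tied to the same end form a flat edge, so only the edge (t, t
    + 1) between the stretches is exempt. *)
Lemma tied_chain (T : eqType) (u : seq T) (h : nat -> T -> bool) q : 0 < q ->
    (forall m, 0 < m < q -> tied u (h 0) (h m) \/ tied u (h q) (h m)) ->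
    (forall l m, 0 < l < m -> m < q -> tied u (h q) (h l) -> ~ tied u (h 0) (h m)) ->
  exists2 t, t < q & forall m, m < q -> m != t ->
    exists c, {in u, forall x, h m x (+) h m.+1 x = c}.
Proof.
move=> q_gt0 tied_m no_mix.
have tied_refl e : tied u e e by exists false => x _; rewrite addbF.
have split_at i : i < q ->
  (forall m, m <= i -> tied u (h 0) (h m)) \/
  exists2 t, t < i & (forall m, m <= t -> tied u (h 0) (h m)) /\
                     (forall m, t < m <= i -> tied u (h q) (h m)).
  elim: i => [_|i IHi lt_i]; first by left=> m; rewrite leqn0 => /eqP->.
  case: (IHi (ltnW lt_i)) => [T0|[t lt_t [T0 Tq]]].
    case: (tied_m i.+1) => //= T1; [left|right; exists i => //; split=> //] => m.
      by rewrite leq_eqVlt => /orP[/eqP->|/T0].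
    by rewrite -eqn_leq => /eqP <-.
  right; exists t; first exact: ltnW.
  split=> // m /andP[lt_tm]; rewrite leq_eqVlt => /orP[/eqP->|le_m]; last first.
    by apply: Tq; rewrite lt_tm.
  case: (tied_m i.+1) => //= T1; case: (no_mix t.+1 i.+1) => //.
  by apply: Tq; rewrite leqnn.
have {split_at} [t lt_t [T0 Tq]] : exists2 t, t < q &
  (forall m, m <= t -> tied u (h 0) (h m)) /\
  (forall m, t < m <= q -> tied u (h q) (h m)).
  have ends t : t < q -> (forall m, t < m <= q.-1 -> tied u (h q) (h m)) ->
      forall m, t < m <= q -> tied u (h q) (h m).
    move=> lt_t Tq m /andP[lt_m]; rewrite leq_eqVlt => /orP[/eqP->//|lt_mq].
    by apply: Tq; rewrite lt_m -ltnS prednK.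
  have ltp : q.-1 < q by rewrite ltn_predL.
  case: (split_at q.-1) => // [T0|[t lt_t [T0 Tq]]]; last first.
    by exists t; [apply: leq_trans lt_t (leq_pred q)|split=> //; apply: ends => //; lia].
  exists q.-1 => //; split=> //; apply: ends => // m; lia.
exists t => // m lt_m neq_m; case: (ltngtP m t) neq_m => // [lt_mt|lt_tm] _.
  by apply: tied_flat (T0 _ _) (T0 _ _) => //; exact: ltnW.
by apply: tied_flat (Tq _ _) (Tq _ _); rewrite ?lt_tm ?(ltnW lt_m) // ltnW.
Qed.

(** * Realizing a quartic move by exchanges *)

Section Kstep.
Variable n : nat.
Local Notation N := n.+1.
Implicit Types (x y r s : state N) (u v w : seq (state N)).

(* [h 0], ..., [h q] reads the positions on one side of the edge (j, j + 1), from
   position 0 to the nearer end point.  When no swap is available, every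
   position is tied to one of these two ends, and only one edge between them can
   be nonflat. *)
Lemma kstep_side (h : nat -> state N -> bool) q u j p : 0 < q -> j < N ->
    quad u j p ->
    (forall g a, exists2 x, x \in u & h 0 x = g /\ h q x = a) ->
    (forall u' r s m, quad u' j p -> r \in u' -> s \in u' -> h 0 r != h 0 s ->
       h q r != h q s -> 0 < m < q -> h m r = h m s -> can_kstep u' j p) ->
    (forall r s m, r \in u -> s \in u -> h 0 r = h 0 s -> 0 < m < q -> h m r = h m s ->
       exists u' r', [/\ conn u u', Teq u u', r' \in u',
         (forall y, y \in u -> h 0 y != h 0 r -> y \in u') &
         (forall l, l <= m -> h l r' = h l r) /\
         (forall l, m <= l <= q -> h l r' = h l s)]) ->
  can_kstep u j p \/ exists2 t, t < q & forall m, m < q -> m != t ->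
    exists c, {in u, forall x, h m x (+) h m.+1 x = c}.
Proof.
move=> q_gt0 lt_j qu ex unblocked mix.
have [|not_k] := pselect (can_kstep u j p); first by left.
right; apply: tied_chain => // [m lt_m|l m /andP[l0 lt_lm] lt_mq [c lc] [c' mc']].
  apply: blocked_tied => // r s ru su z e; apply/eqP => eqm.
  exact/not_k/(unblocked u r s m).
(* Suppose l < m with l tied to q and m tied to 0. Then [x00] and [x01] agree at m and can be mixed
   there; the mixed row differs from [x10] at both ends but agrees with it at l, which makes a
   quartic move available. *)
have [x00 u00 [z00 e00]] := ex false false; have [x01 u01 [z01 e01]] := ex false true.
have [x10 u10 [z10 e10]] := ex true false.
have m0q : 0 < m < q by rewrite (ltn_trans l0 lt_lm).
have eqz : h 0 x00 = h 0 x01 by rewrite z00.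
have eqm : h m x00 = h m x01 by rewrite !mc' // eqz.
have [u' [r' [uu' Tuu' ru' keep [r'l r'm]]]] := mix _ _ m u00 u01 eqz m0q eqm.
case: not_k; apply: (can_kstep_conn uu' Tuu').
apply: (unblocked u' r' x10 l) => //.
- exact: Teq_quad lt_j Tuu' qu.
- by apply: keep; rewrite // z10 z00.
- by rewrite r'l // z00 z10.
- by rewrite r'm ?e01 ?e10 // leqnn (ltnW lt_mq).
- by rewrite l0 (ltn_trans lt_lm).
- by rewrite r'l 1?ltnW // !lc // e00 e10.
Qed.

Lemma quad_row u j p g a : quad u j p ->
  exists x, [/\ x \in u, bit x 0 = g, bit x j = a & bit x j.+1 = p (+) g (+) a].
Proof. by move=> /(_ g a)/cnt_row. Qed.

Lemma quad_row1 u j p g b : quad u j p ->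
  exists x, [/\ x \in u, bit x 0 = g, bit x j = p (+) g (+) b & bit x j.+1 = b].
Proof.
move=> /(quad_row g (p (+) g (+) b))[x [xu x0 xj x1]]; exists x; split=> //.
by rewrite x1; case: p g b {x0 xj x1} => [] [] [].
Qed.

Lemma uniq4 (T : eqType) (f : T -> bool * bool) (a b c d : T) :
  uniq [:: f a; f b; f c; f d] -> uniq [:: a; b; c; d].
Proof. by move=> uf; apply: (@map_uniq _ _ f). Qed.

(** Since [r] and [s] differ at both 0 and j, they agree at j + 1 as soon as both have parity p.
    Agreement at m and j + 1 is what [conn_tails_left] needs. *)
Lemma can_kstep_left u j p r s m : j < N -> quad u j p -> r \in u -> s \in u ->
    bit r 0 != bit s 0 -> bit r j != bit s j -> 0 < m < j -> bit r m = bit s m ->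
  can_kstep u j p.
Proof.
move=> lt_j qu ru su neq0 neqj /andP[m0 lt_mj] eqm.
(* A row is kept up to j and given the bit at j + 1 of parity p. *)
have retarget u1 x : quad u1 j p -> x \in u1 -> exists u2,
    [/\ conn u1 u2, Teq u1 u2, forall y, y \in u1 -> bit y 0 != bit x 0 -> y \in u2 &
    exists x', [/\ x' \in u2, bit x' 0 = bit x 0, bit x' m = bit x m, bit x' j = bit x j &
      bit x' j.+1 = p (+) bit x 0 (+) bit x j]].
  move=> qu1 xu1; set b := _ (+) bit x j.
  have [||u2 [? ? ? [x' x'u2 [x'0 x'p]]]] :=
      @conn_path n u1 (bit x 0) (fun i => if i <= j then bit x i else b) 0 j.+1.
  - by [].
  - move=> i /andP[_]; rewrite ltnS /= => le_ij; rewrite le_ij.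
    case: (ltnP i j) => [_|le_ji]; first exact: cnt_gt0.
    have -> : i = j by apply/eqP; rewrite eqn_leq le_ij.
    exact: qu1.
  exists u2; split=> //; exists x'; split=> //.
  - by rewrite x'p ?(ltnW lt_mj) //= leqW // ltnW.
  - by rewrite x'p ?leqnn //= leqnSn.
  - by rewrite x'p ?leqnn //= ltnn.
have [u1 [uu1 Tuu1 keep1 [r' [r'u1 r'0 r'm r'j r'1]]]] := retarget u r qu ru.
apply: (can_kstep_conn uu1 Tuu1).
have {}qu := Teq_quad lt_j Tuu1 qu.
have su1 : s \in u1 by apply: keep1; rewrite 1?eq_sym.
have [u2 [u12 Tu12 keep2 [s' [s'u2 s'0 s'm s'j s'1]]]] := retarget u1 s qu su1.
apply: (can_kstep_conn u12 Tu12).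
have {}qu := Teq_quad lt_j Tu12 qu.
have r'u2 : r' \in u2 by apply: keep2; rewrite // r'0.
(* The partners lie in the same groups and have the opposite bits at j; the pairs of bits at 0 and j
   show that the four rows are distinct. *)
have [r2 [r2u r20 r2j r21]] := quad_row (bit r 0) (~~ bit r j) qu.
have [s2 [s2u s20 s2j s21]] := quad_row (bit s 0) (~~ bit s j) qu.
have s0E : bit s 0 = ~~ bit r 0 by case: (bit r 0) (bit s 0) neq0 => [] [].
have sjE : bit s j = ~~ bit r j by case: (bit r j) (bit s j) neqj => [] [].
have [||w perm_u] := @uniq_sub_perm _ [:: r'; r2; s'; s2] u2.
- apply: (@uniq4 _ (fun x => (bit x 0, bit x j))).
  rewrite r'0 s'0 r20 s20 r'j s'j r2j s2j s0E sjE.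
  by case: (bit r 0) (bit r j) => [] [].
- by move=> x; rewrite !inE => /or4P[] /eqP->.
exists [:: tail j r' r2, tail j r2 r', tail j s' s2, tail j s2 s' & w].
  apply: conn_trans (conn_perm perm_u) _.
  apply: (@conn_tails_left n m) => //; rewrite ?r'0 ?s'0 ?r'm ?s'm ?r'1 ?s'1 ?r21 ?s21 //.
  - by rewrite s0E sjE; rewrite !(addbN, addNb, negbK).
  - by rewrite s0E sjE; rewrite !(addbN, addNb, negbK).
  - by rewrite r2j s'j sjE.
  - by rewrite s2j r'j sjE negbK.
move=> g l a b lt_l; rewrite (perm_Teq perm_u g a b lt_l).
apply: kstep_tails => //; rewrite ?r'0 ?s'0 ?r'j ?s'j ?r20 ?s20 //.
- by rewrite r2j.
- by rewrite s2j.
Qed.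

(** As on the left side, with j and j + 1 interchanged: the rows are kept from j + 1 on and the
    parity is adjusted at j. *)
Lemma can_kstep_right u j p r s m : j.+1 < N -> quad u j p -> r \in u -> s \in u ->
    bit r 0 != bit s 0 -> bit r j.+1 != bit s j.+1 -> j.+1 < m < N -> bit r m = bit s m ->
  can_kstep u j p.
Proof.
move=> lt_j1 qu ru su neq0 neqj /andP[lt_jm lt_m] eqm.
have lt_j := ltnW lt_j1.
have retarget u1 x : quad u1 j p -> x \in u1 -> exists u2,
    [/\ conn u1 u2, Teq u1 u2, forall y, y \in u1 -> bit y 0 != bit x 0 -> y \in u2 &
    exists x', [/\ x' \in u2, bit x' 0 = bit x 0, bit x' m = bit x m,
      bit x' j.+1 = bit x j.+1 & bit x' j = p (+) bit x 0 (+) bit x j.+1]].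
  move=> qu1 xu1; set b := _ (+) bit x j.+1.
  have [||u2 [? ? ? [x' x'u2 [x'0 x'p]]]] :=
      @conn_path n u1 (bit x 0) (fun i => if j < i then bit x i else b) j N.
  - by rewrite lt_j leqnn.
  - move=> i /andP[le_ji lt_i]; rewrite /= ltnS le_ji.
    case: (ltnP j i) => [_|le_ij]; first exact: cnt_gt0.
    have -> : i = j by apply/eqP; rewrite eqn_leq le_ij.
    have [y [yu1 y0 yj y1]] := quad_row1 (bit x 0) (bit x j.+1) qu1.
    by rewrite -y1 -[b]yj -y0; apply: cnt_gt0.
  exists u2; split=> //; exists x'; split=> //.
  - by rewrite x'p ?(ltnW lt_jm) ?(ltnW (ltnW lt_jm)) 1?ltnW.
  - by rewrite x'p ?leqnSn ?leqnn // ltnW.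
  - by rewrite x'p ?leqnn ?ltnn // ltnW.
have [u1 [uu1 Tuu1 keep1 [r' [r'u1 r'0 r'm r'1 r'j]]]] := retarget u r qu ru.
apply: (can_kstep_conn uu1 Tuu1).
have {}qu := Teq_quad lt_j Tuu1 qu.
have su1 : s \in u1 by apply: keep1; rewrite 1?eq_sym.
have [u2 [u12 Tu12 keep2 [s' [s'u2 s'0 s'm s'1 s'j]]]] := retarget u1 s qu su1.
apply: (can_kstep_conn u12 Tu12).
have {}qu := Teq_quad lt_j Tu12 qu.
have r'u2 : r' \in u2 by apply: keep2; rewrite // r'0.
have [r2 [r2u r20 r21 r2j]] := quad_row1 (bit r 0) (~~ bit r j.+1) qu.
have [s2 [s2u s20 s21 s2j]] := quad_row1 (bit s 0) (~~ bit s j.+1) qu.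
have s0E : bit s 0 = ~~ bit r 0 by case: (bit r 0) (bit s 0) neq0 => [] [].
have s1E : bit s j.+1 = ~~ bit r j.+1 by case: (bit r j.+1) (bit s j.+1) neqj => [] [].
have [||w perm_u] := @uniq_sub_perm _ [:: r'; r2; s'; s2] u2.
- apply: (@uniq4 _ (fun x => (bit x 0, bit x j.+1))).
  rewrite r'0 s'0 r20 s20 r'1 s'1 r2j s2j s0E s1E.
  by case: (bit r 0) (bit r j.+1) => [] [].
- by move=> x; rewrite !inE => /or4P[] /eqP->.
exists [:: tail j r' r2, tail j r2 r', tail j s' s2, tail j s2 s' & w].
  apply: conn_trans (conn_perm perm_u) _.
  apply: (@conn_tails_right n m); rewrite ?(ltnW lt_m) ?r'0 ?s'0 ?r'm ?s'm ?r'j ?s'j ?r21 ?s21 //.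
  - by rewrite s0E s1E; rewrite !(addbN, addNb, negbK).
  - by rewrite s0E s1E; rewrite !(addbN, addNb, negbK).
  - by rewrite r2j s'1 s1E.
  - by rewrite s2j r'1 s1E negbK.
move=> g l a b lt_l; rewrite (perm_Teq perm_u g a b lt_l).
apply: kstep_tails; rewrite ?r'0 ?s'0 ?r'j ?s'j ?r20 ?s20 ?r21 ?s21 ?r'1 ?s'1 ?r2j ?s2j //;
  by rewrite ?addbK3 ?s0E ?s1E ?(addbN, addNb, negbK).
Qed.

End Kstep.

(** * Either a quartic move or at most three nonflat edges *)

Section KstepOrFlat.
Variable n : nat.
Local Notation N := n.+1.
Implicit Types (x y r s : state N) (u v w : seq (state N)).

Definition flat u l := exists c, {in u, forall x, bit x l (+) bit x l.+1 = c}.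

Lemma mix_rows u r s m : r \in u -> s \in u -> bit r 0 = bit s 0 -> bit r m = bit s m ->
  exists u' r', [/\ conn u u', Teq u u', r' \in u',
    forall y, y \in u -> bit y 0 != bit r 0 -> y \in u' &
    forall l, l <= N -> bit r' l = if l <= m then bit r l else bit s l].
Proof.
move=> ru su eq0 eqm.
have [||u' [? ? ? [r' r'u' [r'0 r'p]]]] :=
  @conn_path n u (bit r 0) (fun l => if l <= m then bit r l else bit s l) 0 N.
- by rewrite leqnn.
- move=> l _ /=; have [le_lm|lt_ml] := leqP l m; last first.
    by rewrite [l < m]ltnNge (ltnW lt_ml) /= eq0 cnt_gt0.
  have [lt_lm|le_ml] := ltnP l m; first exact: cnt_gt0.
  have -> : l = m by lia.
  by rewrite eq0 eqm cnt_gt0.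
by exists u', r'; split=> // l le_l; apply: r'p.
Qed.

(** [kstep_side] is applied to the stretch from 0 to j and to the stretch from N down to j + 1. If
    no move is available, each side has at most one nonflat edge, and j is the third. *)
Lemma can_kstep_or_flat u j p : j < N -> quad u j p ->
  can_kstep u j p \/
  exists t1 t3, [/\ t1 < j, j < t3 < N &
    forall l, l < N -> l \notin [:: t1; j; t3] -> flat u l].
Proof.
move=> lt_j qu.
(* If j or j + 1 were the vertex 0, its bit would be fixed by the group and some cells of [quad]
   would be empty. *)
have j_gt0 : 0 < j.
  rewrite lt0n; apply/eqP => j0.
  by have [x [_ x0 xj _]] := quad_row false true qu; rewrite j0 x0 in xj.
have lt_j1 : j.+1 < N.
  rewrite ltn_neqAle lt_j andbT; apply/eqP => jN.
  have [x [_ x0 _]] := quad_row true (~~ p) qu.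
  by rewrite jN bitN x0; case: (p).
have [g a|u' r s m qu' ru su z e lt_m eqm|r s m ru su eq0 lt_m eqm||]//= :=
  @kstep_side n (fun m x => bit x m) j u j p j_gt0 lt_j qu.
- by have [x [xu x0 xj _]] := quad_row g a qu; exists x.
- exact: (@can_kstep_left n u' j p r s m).
- have [u' [r' [uu' Tuu' r'u' keep r'l]]] := mix_rows ru su eq0 eqm.
  exists u', r'; split=> //.
  split=> l; first by move=> le_l; rewrite r'l ?le_l //; lia.
  move=> /andP[le_ml le_lj]; rewrite r'l; last by lia.
  by case: ifP => // le_lm; have -> : l = m by lia.
- by left.
move=> [t1 lt_t1 flat1].
(* On the second side positions are read backwards, from N, which is the vertex 0, to j + 1. *)
have hq : N - (N - j.+1) = j.+1 by rewrite subKn.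
have [|g a|u' r s m qu'|r s m ru su||]//= :=
  @kstep_side n (fun m x => bit x (N - m)) (N - j.+1) u j p _ lt_j qu.
- by rewrite subn_gt0.
- have [x [xu x0 xj x1]] := quad_row1 g a qu.
  by exists x; rewrite // hq subn0 bitN.
- rewrite subn0 !bitN hq => ru su z e /andP[m_gt0 lt_m] eqm.
  by apply: (@can_kstep_right n u' j p r s (N - m)) => //; lia.
- rewrite subn0 !bitN => eq0 /andP[m_gt0 lt_m] eqm.
  (* Reading backwards interchanges the parts of [r] and [s] in the mixture. *)
  have [u' [r' [uu' Tuu' r'u' keep r'l]]] := mix_rows su ru (esym eq0) (esym eqm).
  exists u', r'; split=> //; first by move=> y yu; rewrite bitN -?eq0 => neq; apply: keep; rewrite -?eq0.
  split=> l; last first.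
    by move=> /andP[le_ml le_lq]; rewrite r'l ?leq_subr // leq_sub2l.
  move=> le_lm; rewrite r'l ?leq_subr //; case: ifP => // le.
  by have -> : l = m by lia.
- by left.
(* The backward step from t to t + 1 is the edge that starts at N - (t + 1). *)
move=> [t lt_t flat3]; right; exists t1, (N - t.+1); split=> //; first by lia.
move=> l lt_l; rewrite !inE !negb_or => /and3P[l1 lj l3].
have [lt_lj|le_jl] := ltnP l j; first exact: flat1.
have [||c cl] := flat3 (N - l.+1); [by lia|by lia|].
exists c => x xu; rewrite -(cl x xu) addbC; congr (bit x _ (+) bit x _); lia.
Qed.

End KstepOrFlat.

(** * Differences of flows on a layered graph with two nodes per layer *)

Section Flow.
Local Open Scope ring_scope.
Import Order.TTheory GRing.Theory Num.Theory.
Variables (N : nat) (F : nat -> bool -> bool -> int).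
Hypothesis conserve : forall l c, (l.+1 < N)%N ->
  F l false c + F l true c = F l.+1 c false + F l.+1 c true.
Hypothesis total : forall l, (l < N)%N ->
  F l false false + F l false true + F l true false + F l true true = 0.
Hypothesis start : forall c, F 0%N c false + F 0%N c true = 0.
Hypothesis finish : forall l c, l.+1 = N -> F l false c + F l true c = 0.

(** As the total is 0, the other node has negative outflow. A positive path from c and a negative
    path from the other node are continued until they meet; they meet by layer N because all inflow
    there is 0. *)
Lemma flow_walk t l c : (l < N)%N -> (l + t = N)%N -> 0 < F l c false + F l c true ->
  exists k p q, [/\ (l < k <= N)%N, p l = c, q l = ~~ c, p k = q k &
    forall m, (l <= m < k)%N -> 0 < F m (p m) (p m.+1) /\ F m (q m) (q m.+1) < 0].
Proof.
elim: t l c => [|t IHt] l c lt_l eq_l pos_c; first by move: lt_l; rewrite -eq_l addn0 ltnn.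
have neg_c : F l (~~ c) false + F l (~~ c) true < 0.
  by have := total lt_l; move: pos_c; case: (c) => /=; lia.
have [[b b1 b2]|no_merge] := pselect (exists2 b, 0 < F l c b & F l (~~ c) b < 0).
  exists l.+1, (fun m => if m == l then c else b), (fun m => if m == l then ~~ c else b).
  rewrite eqxx (gtn_eqF (ltnSn l)); split=> //; first by rewrite ltnSn.
  move=> m lt_m; have -> : m = l by clear -lt_m; lia.
  by rewrite eqxx (gtn_eqF (ltnSn l)).
have nm b : 0 < F l c b -> 0 <= F l (~~ c) b.
  by move=> pos_b; rewrite leNgt; apply/negP => neg_b; apply: no_merge; exists b.
(* If the paths cannot meet in the next layer, the positive one goes to [b] and the negative one to
   the other node; then [b] has positive inflow, hence positive outflow. *)
have [b [b1 b2 b3]] : exists b, [/\ 0 < F l c b, 0 <= F l (~~ c) b & F l c (~~ b) <= 0].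
  have := nm false; have := nm true; clear -pos_c neg_c => n1 n0.
  by have [pos_f|neg_f] := ltrP 0 (F l c false); [exists false|exists true]; split=> /=; lia.
have pos_b : 0 < F l false b + F l true b.
  by clear -neg_c b1 b2 b3; move: neg_c b1 b2 b3; case: b; case: c => /=; lia.
have [lt_l1|le_l1] := ltnP l.+1 N; last first.
  by move: pos_b; rewrite finish ?ltxx //; apply/eqP; rewrite eqn_leq lt_l.
rewrite conserve // in pos_b.
have eq_l1 : (l.+1 + t = N)%N by rewrite addSnnS.
have [k [p [q [lt_k pb qb eq_k pq]]]] := IHt l.+1 b lt_l1 eq_l1 pos_b.
exists k, (fun m => if m == l then c else p m), (fun m => if m == l then ~~ c else q m).
have lt_lk : (l < k)%N by clear -lt_k; lia.
rewrite eqxx (gtn_eqF lt_lk); split=> //; first by clear -lt_k; lia.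
move=> m lt_m; have lt_lm1 : (l < m.+1)%N by clear -lt_m; lia.
rewrite (gtn_eqF lt_lm1); have [->|neq_ml] := eqVneq m l; last by apply: pq; clear -lt_m neq_ml; lia.
rewrite pb qb; split=> //; clear -neg_c b2; move: neg_c b2; case: (b); case: (c) => /=; lia.
Qed.

(** In the layer before the first one with a nonzero node value, some node sends a positive amount
    to the positive node c. Its own value is 0, so it sends a negative amount to the other node:
    there the two paths of [flow_walk] get a common start. *)
Lemma flow_segment l c : (l < N)%N -> F l c false + F l c true != 0 ->
  exists i k p q, [/\ (i < k <= N)%N, p i = q i, p k = q k &
    forall m, (i <= m < k)%N -> 0 < F m (p m) (p m.+1) /\ F m (q m) (q m.+1) < 0].
Proof.
move=> lt_l neq0.
have ex : exists l, (l < N)%N && [exists c, F l c false + F l c true != 0].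
  by exists l; rewrite lt_l; apply/existsP; exists c.
case: (ex_minnP ex) => {l c lt_l neq0} -[|l] /andP[lt_l /existsP[c neq0] min_l].
  by rewrite start eqxx in neq0.
have zero_l a : F l a false + F l a true = 0.
  apply/eqP; apply: contraT => neq; have := min_l l; rewrite (ltnW lt_l) ltnn.
  by move=> /(_ (introT existsP (ex_intro _ a neq))).
have {c neq0} [c pos_c] : exists c, 0 < F l.+1 c false + F l.+1 c true.
  have := total lt_l; have [|neg] := ltrP 0 (F l.+1 c false + F l.+1 c true); first by exists c.
  by move=> tot; exists (~~ c); clear -tot neq0 neg; move: neq0 neg; case: c => /=; lia.
have [a pos_a] : exists a, 0 < F l a c.
  by have := conserve c lt_l; have [?|?] := ltrP 0 (F l false c); [exists false|exists true; lia].
have neg_a : F l a (~~ c) < 0 by have := zero_l a; case: (c) pos_a => /=; lia.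
have [k [p [q [lt_k pb qb eq_k pq]]]] := flow_walk lt_l (subnKC (ltnW lt_l)) pos_c.
exists l, k, (fun m => if m == l then a else p m), (fun m => if m == l then a else q m).
rewrite eqxx; split=> //; [lia| |].
  by rewrite gtn_eqF //; lia.
move=> m lt_m; rewrite (gtn_eqF (_ : l < m.+1)%N); last by lia.
have [->|neq_ml] := eqVneq m l; last by apply: pq; lia.
by rewrite pb qb.
Qed.

End Flow.

(** * The l^1 distance between two tables of counts *)

Definition table_dist (c t : bool -> bool -> nat) : nat :=
  let d a b := (c a b - t a b) + (t a b - c a b) in
  d false false + d false true + d true false + d true true.

Lemma table_dist_move (w t : bool -> bool -> nat) p p' q q' :
  let c a b := ((p == a) && (p' == b)) + w a b in
  let c' a b := ((q == a) && (q' == b)) + w a b in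
  t p p' < c p p' -> c q q' < t q q' -> table_dist c' t < table_dist c t.
Proof.
rewrite /table_dist; case: p; case: p'; case: q; case: q' => /=; lia.
Qed.

Lemma table_dist_quad (c c' t : bool -> bool -> nat) (p : bool) :
    (forall a b, c a b + (b != p (+) a) = c' a b + (b == p (+) a)) ->
    (forall a, t a (p (+) a) < c a (p (+) a)) ->
    (forall a, c a (~~ (p (+) a)) < t a (~~ (p (+) a))) ->
  table_dist c' t < table_dist c t.
Proof.
move=> cc' lt_t gt_t; rewrite /table_dist.
have := cc' false false; have := cc' false true; have := cc' true false; have := cc' true true.
have := lt_t false; have := lt_t true; have := gt_t false; have := gt_t true.
by clear; case: p => /=; lia.
Qed.

(** * Connectedness of the fibres of the toric map *)

Section Fibers.
Variable n : nat.
Local Notation N := n.+1.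
Implicit Types (x y r s : state N) (u v w : seq (state N)).

Definition edge l a b x := (bit x l == a) && (bit x l.+1 == b).

Definition Eeq u v := forall l a b, l < N -> count (edge l a b) u = count (edge l a b) v.

Definition node u g l c := count (fun x => (bit x 0 == g) && (bit x l == c)) u.

Lemma cnt_edge u l a b : cnt u false l a b + cnt u true l a b = count (edge l a b) u.
Proof.
elim: u => //= x u <-; rewrite /tri /edge addnACA; congr (_ + _).
by case: (bit x 0); rewrite /= ?addn0 ?add0n.
Qed.

Lemma cnt_out u g l c : cnt u g l c false + cnt u g l c true = node u g l c.
Proof.
elim: u => //= x u <-; rewrite /tri addnACA; congr (_ + _).
by case: (bit x l.+1); rewrite ?andbT ?andbF ?addn0 ?add0n.
Qed.

Lemma cnt_in u g l c : cnt u g l false c + cnt u g l true c = node u g l.+1 c.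
Proof.
elim: u => //= x u <-; rewrite /tri addnACA; congr (_ + _).
by case: (bit x l) => /=; rewrite ?andbT ?andbF ?addn0 ?add0n.
Qed.

Lemma node_total u g l : node u g l false + node u g l true = node u g 0 g.
Proof.
elim: u => //= x u <-; rewrite addnACA; congr (_ + _).
by case: (bit x l); case: (bit x 0); case: (g).
Qed.

Lemma node0 u g : node u g 0 (~~ g) = 0.
Proof. by elim: u => //= x u ->; case: (bit x 0); case: (g). Qed.

Lemma nodeN u g c : node u g N c = node u g 0 c.
Proof. by apply: eq_count => x; rewrite bitN. Qed.

Lemma Eeq_sum u v l a b : Eeq u v -> l < N ->
  cnt u false l a b + cnt u true l a b = cnt v false l a b + cnt v true l a b.
Proof. by move=> Euv lt_l; rewrite !cnt_edge Euv. Qed.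

(** On the edge (0, 1) the group is visible as the first bit, so the edge counts there determine the
    group sizes. *)
Lemma Eeq_node0 u v g c : Eeq u v -> node u g 0 c = node v g 0 c.
Proof.
move=> Euv; have [->|neq_cg] := eqVneq c (~~ g); first by rewrite !node0.
have -> : c = g by case: c g neq_cg => [] [].
rewrite -!cnt_out; have z (w : seq (state N)) b : cnt w (~~ g) 0 g b = 0.
  apply/eqP; rewrite -leqn0 leqNgt -has_count; apply/hasPn => x _.
  by rewrite /tri; case: (bit x 0); case: (g).
have := Eeq_sum g false Euv (ltn0Sn n); have := Eeq_sum g true Euv (ltn0Sn n).
have := z u false; have := z u true; have := z v false; have := z v true.
by clear; case: g => /=; lia.
Qed.

Lemma edge_swap i k x y l a b : k <= N -> bit x i = bit y i -> bit x k = bit y k -> l < N ->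
  edge l a b (swap i k x y) = edge l a b (if i <= l < k then y else x).
Proof.
move=> le_k eqi eqk lt_l; rewrite /edge !bit_swap ?(ltnW lt_l) //= ltnS.
have [le_il|lt_li] := leqP i l; last first.
  by rewrite [i < l]ltnNge (ltnW lt_li).
have [le_kl|lt_lk] := leqP k l.
  by rewrite [l.+1 < k]ltnNge (leqW le_kl) !andbF.
rewrite ?andbT ?andTb.
have -> : (if i < l then bit y l else bit x l) = bit y l.
  by case: ltnP => // le_li; have -> : l = i by clear -le_li le_il; lia.
have -> // : (if l.+1 < k then bit y l.+1 else bit x l.+1) = bit y l.+1.
by case: ltnP => // le_kl; have -> : l.+1 = k by clear -le_kl lt_lk; lia.
Qed.

Lemma conn_Eeq u v : conn u v -> Eeq u v.
Proof.
elim=> {u v} [u v /permP eq_uv|i k x y u _ le_k eqi eqk|u v w _ uv _ vw] l a b lt_l.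
- exact: eq_uv.
- rewrite /= !edge_swap //; case: ifP => // _; rewrite !addnA; congr (_ + _); exact: addnC.
- by rewrite uv ?vw.
Qed.

Lemma flat_Eeq u v l : l < N -> Eeq u v -> flat u l -> flat v l.
Proof.
move=> lt_l Euv [c fc]; exists c => x xv.
have : has (edge l (bit x l) (bit x l.+1)) u.
  by rewrite has_count Euv // -has_count; apply/hasP; exists x; rewrite // /edge !eqxx.
by case/hasP => y yu /andP[/eqP <- /eqP <-]; apply: fc.
Qed.

Definition four_nonflat v := forall t1 t2 t3, t1 < t2 -> t2 < t3 -> t3 < N ->
  ~ (forall l, l < N -> l \notin [:: t1; t2; t3] -> flat v l).

(** Measuring the group [false] suffices: when the edge counts agree, they determine the counts of
    the other group. *)
Definition dist u v := \sum_(l < N) table_dist (cnt u false l) (cnt v false l).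

Lemma dist_lt u u' v i : i < N ->
    (forall l, l < N -> table_dist (cnt u' false l) (cnt v false l) <=
                        table_dist (cnt u false l) (cnt v false l)) ->
    table_dist (cnt u' false i) (cnt v false i) <
      table_dist (cnt u false i) (cnt v false i) ->
  dist u' v < dist u v.
Proof.
move=> lt_i le_d lt_d; rewrite /dist (bigD1 (Ordinal lt_i)) //= [ltnRHS](bigD1 (Ordinal lt_i)) //=.
rewrite -addSn leq_add //; apply: leq_sum => l _; exact: le_d.
Qed.

Lemma eq_table_dist c c' t : c =2 c' -> table_dist c t = table_dist c' t.
Proof. by move=> eq_c; rewrite /table_dist !eq_c. Qed.

(* If some node count differs, the difference of the two flows of group [false]
   contains a positive and a negative path with common end points, which a
   single swap between the groups exchanges. *)
Lemma node_step u v l c : Eeq u v -> l < N -> node u false l c != node v false l c ->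
  exists2 u', conn u u' & dist u' v < dist u v.
Proof.
move=> Euv lt_l neq_node.
pose F l a b := ((cnt u false l a b)%:Z - (cnt v false l a b)%:Z)%R.
have Fout m a : (F m a false + F m a true = (node u false m a)%:Z - (node v false m a)%:Z)%R.
  by rewrite -!cnt_out /F; clear; lia.
have Fin m a : (F m false a + F m true a = (node u false m.+1 a)%:Z - (node v false m.+1 a)%:Z)%R.
  by rewrite -!cnt_in /F; clear; lia.
have F0 a : (F 0 a false + F 0 a true = 0)%R.
  by rewrite Fout (Eeq_node0 _ _ Euv) GRing.subrr.
have [||||i [k [p [q [/andP[lt_ik le_k] eqi eqk pq]]]]] := @flow_segment N F _ _ F0 _ l c lt_l.
- by move=> m a _; rewrite Fin Fout.
- move=> m _; have := Fout m false; have := Fout m true.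
  have := node_total u false m; have := node_total v false m.
  have := Eeq_node0 false false Euv; clear; lia.
- by move=> m a eq_m; rewrite Fin eq_m !nodeN (Eeq_node0 _ _ Euv) GRing.subrr.
- by rewrite Fout GRing.subr_eq0; move: neq_node; clear; lia.
have [|m lt_m|u1 [uu1 Tuu1 keep1 [r ru1 [r0 rp]]]] := @conn_path n u false p i k.
- by rewrite lt_ik.
- by have [] := pq m lt_m; rewrite /F; clear; lia.
(* Where the group [false] of [u] has too few rows, the group [true] has too many, because the edge
   counts agree. So the negative path is realized in the group [true]. *)
have [|m lt_m|u2 [u12 Tu12 keep2 [s su2 [s0 sq]]]] := @conn_path n u1 true q i k.
- by rewrite lt_ik.
- have lt_mN : m < N by case/andP: lt_m => _ /leq_trans; apply.
  rewrite -Tuu1 //; have [_] := pq m lt_m; rewrite /F.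
  have := Eeq_sum (q m) (q m.+1) Euv lt_mN; clear; lia.
have ru2 : r \in u2 by apply: keep2; rewrite // r0.
have perm_u := perm_pick2 ru2 su2 (_ : r <> s).
have {perm_u} perm_u : perm_eq u2 [:: r, s & rem s (rem r u2)].
  by apply: perm_u => eq_rs; rewrite eq_rs s0 in r0.
set w := rem _ _ in perm_u.
have eqri : bit r i = bit s i by rewrite rp ?sq // leqnn ltnW.
have eqrk : bit r k = bit s k by rewrite rp ?sq // leqnn ltnW.
exists [:: swap i k r s, swap i k s r & w].
  apply: (conn_trans uu1); apply: (conn_trans u12); apply: conn_trans (conn_perm perm_u) _.
  exact: conn_swap.
have Tu : Teq u [:: r, s & w].
  exact: Teq_trans Tuu1 (Teq_trans Tu12 (perm_Teq perm_u)).
have cu m : m < N -> cnt u false m =2 fun a b => edge m a b r + cnt w false m a b.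
  by move=> lt_m a b; rewrite Tu // /cnt /= /tri r0 s0 /= add0n.
have cu' m : m < N -> cnt [:: swap i k r s, swap i k s r & w] false m =2
    fun a b => edge m a b (if i <= m < k then s else r) + cnt w false m a b.
  move=> lt_m a b; rewrite -edge_swap // /cnt /= /tri !bit_swap ?(ltnW lt_m) //= r0 s0 /= add0n.
  by rewrite /edge !bit_swap // ltnW.
have lt_d m : i <= m < k ->
  table_dist (cnt [:: swap i k r s, swap i k s r & w] false m) (cnt v false m) <
  table_dist (cnt u false m) (cnt v false m).
  move=> lt_m; have lt_mN : m < N by case/andP: lt_m => _ /leq_trans; apply.
  rewrite (eq_table_dist _ (cu' m lt_mN)) (eq_table_dist _ (cu m lt_mN)) lt_m /edge.
  have le_m : i <= m <= k by case/andP: lt_m => -> /ltnW.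
  have le_m1 : i <= m.+1 <= k by case/andP: lt_m => /leqW -> ->.
  have [pos neg] := pq m lt_m; rewrite !rp // !sq //.
  move: pos neg; rewrite /F !cu // /edge !rp // => pos neg.
  by apply: table_dist_move; [clear -pos|clear -neg]; lia.
apply: (@dist_lt _ _ _ i) => [||]; [exact: leq_trans le_k|move=> m lt_m|by rewrite lt_d ?leqnn].
have [/lt_d/ltnW//|out] := boolP (i <= m < k).
by rewrite (eq_table_dist _ (cu' m lt_m)) (eq_table_dist _ (cu m lt_m)) (negbTE out).
Qed.

(** Equal node counts mean equal row and column sums of the tables of group [false]. At an edge
    where they differ, the excess of [u] is therefore positive on one diagonal and negative on the
    other, and a quartic move reduces it. *)
Lemma quad_step u v : Eeq u v -> four_nonflat v -> 
    (forall l c, l < N -> node u false l c = node v false l c) ->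
    ~ Teq u v -> exists2 u', conn u u' & dist u' v < dist u v.
Proof.
move=> Euv nonflat eq_node nT.
have [l [lt_l [a [b neq_ab]]]] : exists l, l < N /\ exists a b, cnt u false l a b <> cnt v false l a b.
  apply: contra_notP nT => nex g l a b lt_l.
  have eqf : cnt u false l a b = cnt v false l a b.
    by apply: contra_notP nex => neq; exists l; split=> //; exists a, b.
  case: g; last exact: eqf.
  by have := Eeq_sum a b Euv lt_l; rewrite eqf; apply: addnI.
have eq_out c : cnt u false l c false + cnt u false l c true =
    cnt v false l c false + cnt v false l c true by rewrite !cnt_out eq_node.
have eq_in c : cnt u false l false c + cnt u false l true c =
    cnt v false l false c + cnt v false l true c.
  rewrite !cnt_in; have [lt_l1|le_l1] := ltnP l.+1 N; first exact: eq_node.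
  have -> : l.+1 = N by apply/eqP; rewrite eqn_leq lt_l.
  by rewrite !nodeN eq_node.
have [p [gt_p lt_p]] : exists p,
  (forall a, cnt v false l a (p (+) a) < cnt u false l a (p (+) a)) /\
  (forall a, cnt u false l a (~~ (p (+) a)) < cnt v false l a (~~ (p (+) a))).
  have [lt_c|le_c] := ltnP (cnt v false l a b) (cnt u false l a b);
    [exists (a (+) b)|exists (~~ (a (+) b))].
  all: move: (eq_out false) (eq_out true) (eq_in false) (eq_in true).
    clear -lt_c; move: lt_c; case: a; case: b => /= lt_c o0 o1 i0 i1; split; case=> /=; lia.
  clear -le_c neq_ab; move: le_c neq_ab; case: a; case: b => /= le_c neq_ab o0 o1 i0 i1;
    split; case=> /=; lia.
(* In group [false] the cells of parity p exceed those of [v]. In group [true] they are the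
   complementary cells, which also exceed those of [v] by equality of the edge counts. *)
have qu : quad u l p.
  case=> c; last first.
    by rewrite addbF; apply: leq_ltn_trans (gt_p c).
  have := Eeq_sum c (~~ (p (+) c)) Euv lt_l; have := lt_p c.
  by rewrite addbT addNb; clear; lia.
have [[u' uu' Ku']|[t1 [t3 [lt_t1 /andP[lt_t3 lt_t3N] flat_u]]]] := can_kstep_or_flat lt_l qu; last first.
  case: (nonflat _ _ _ lt_t1 lt_t3 lt_t3N) => m lt_m out.
  exact: flat_Eeq lt_m Euv (flat_u m lt_m out).
exists u' => //; apply: (@dist_lt _ _ _ l) => // [m lt_m|]; last first.
  apply: (@table_dist_quad _ _ _ p) => // c d.
  by have := Ku' false l c d lt_l; rewrite eqxx addbF.
have [->|neq_ml] := eqVneq m l.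
  apply/ltnW/(@table_dist_quad _ _ _ p) => // c d.
  by have := Ku' false l c d lt_l; rewrite eqxx addbF.
rewrite leq_eqVlt; apply/orP; left; apply/eqP/eq_table_dist => c d.
by have := Ku' false m c d lt_m; rewrite (negbTE neq_ml) !addn0.
Qed.

(** Induction on [dist]: node counts are corrected first, then single edges, until [Teq_conn]
    applies. *)
Lemma fiber_connected u v : Eeq u v -> four_nonflat v -> conn u v.
Proof.
move=> + nonflat; have [d] := ubnP (dist u v).
elim: d u => // d IHd u lt_d Euv.
have [Tuv|nT] := pselect (Teq u v); first exact: Teq_conn.
have [u' uu' lt_u'] : exists2 u', conn u u' & dist u' v < dist u v.
  have [[l [c [lt_l neq]]]|all_eq] :=
      pselect (exists l c, l < N /\ node u false l c != node v false l c).
    exact: node_step neq.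
  apply: quad_step => // l c lt_l; apply/eqP; apply: contra_notT all_eq => neq.
  by exists l, c.
apply: (conn_trans uu'); apply: IHd; first exact: leq_trans lt_u' _.
by move=> l a b lt_l; rewrite -(conn_Eeq uu') // Euv.
Qed.

End Fibers.

(** * Generated ideals *)

Section IdealGen.
Import GRing.Theory.
Local Open Scope ring_scope.
Variables (R : comNzRingType) (G : set R).
Implicit Types f g : R.

Lemma ideal_gen0 : ideal_gen G 0.
Proof. by exists [::]; rewrite big_nil. Qed.

Lemma ideal_genD f g : ideal_gen G f -> ideal_gen G g -> ideal_gen G (f + g).
Proof.
move=> [s [Gs ->]] [t [Gt ->]]; exists (s ++ t); rewrite big_cat; split=> // cg.
by rewrite mem_cat => /orP[/Gs|/Gt].
Qed.

Lemma ideal_genM c f : ideal_gen G f -> ideal_gen G (c * f).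
Proof.
move=> [s [Gs ->]]; exists [seq (c * cg.1, cg.2) | cg <- s]; split.
  by move=> _ /mapP[cg /Gs Gcg ->].
by rewrite big_map mulr_sumr; apply: eq_bigr => cg _; rewrite mulrA.
Qed.

Lemma ideal_gen_incl f : G f -> ideal_gen G f.
Proof.
move=> Gf; exists [:: (1, f)]; rewrite big_seq1 mul1r; split=> // cg.
by rewrite inE => /eqP->.
Qed.

Lemma ideal_gen_sum (I : eqType) (r : seq I) (F : I -> R) :
  (forall i, i \in r -> ideal_gen G (F i)) -> ideal_gen G (\sum_(i <- r) F i).
Proof.
by move=> IF; rewrite big_seq; elim/big_ind: _ => //; [exact: ideal_gen0|exact: ideal_genD].
Qed.

Lemma ideal_gen_sub (S : comNzRingType) (phi : {rmorphism R -> S}) f :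
  (forall g, G g -> phi g = 0) -> ideal_gen G f -> phi f = 0.
Proof.
move=> phiG [s [Gs ->]]; rewrite rmorph_sum big_seq big1 // => cg /Gs Gcg.
by rewrite rmorphM [phi cg.2]phiG // mulr0.
Qed.

End IdealGen.

(** * Elements congruent to their image under an endomorphism *)

Section FixedMod.
Import GRing.Theory.
Local Open Scope ring_scope.
Variables (R : comNzRingType) (G : set R) (phi : {rmorphism R -> R}).
Implicit Types H K : R.

(** These elements form a subring, so for polynomials it is enough to check coefficients and
    indeterminates. *)
Definition fixed_mod H := ideal_gen G (H - phi H).

Lemma fixed_mod_eq H : H = phi H -> fixed_mod H.
Proof. by move=> eqH; rewrite /fixed_mod -eqH subrr; exact: ideal_gen0. Qed.

Lemma fixed_modD H K : fixed_mod H -> fixed_mod K -> fixed_mod (H + K).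
Proof.
by move=> fH fK; rewrite /fixed_mod rmorphD opprD addrACA; exact: ideal_genD.
Qed.

Lemma fixed_modM H K : fixed_mod H -> fixed_mod K -> fixed_mod (H * K).
Proof.
move=> fH fK; rewrite /fixed_mod.
have -> : H * K - phi (H * K) = H * (K - phi K) + phi K * (H - phi H).
  by rewrite rmorphM !mulrBr addrA [phi K * H]mulrC subrK [phi K * _]mulrC.
by apply: ideal_genD; apply: ideal_genM.
Qed.

Lemma fixed_mod_sum (I : Type) (r : seq I) (F : I -> R) :
  (forall i, fixed_mod (F i)) -> fixed_mod (\sum_(i <- r) F i).
Proof.
move=> fF; elim/big_ind: _ => //; last exact: fixed_modD.
by apply: fixed_mod_eq; rewrite rmorph0.
Qed.

Lemma fixed_mod_prod (I : Type) (r : seq I) (F : I -> R) :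
  (forall i, fixed_mod (F i)) -> fixed_mod (\prod_(i <- r) F i).
Proof.
move=> fF; elim/big_ind: _ => //; last exact: fixed_modM.
by apply: fixed_mod_eq; rewrite rmorph1.
Qed.

End FixedMod.

(** * Kernels of homomorphisms into a domain *)

Section Kernel.
Import GRing.Theory.
Local Open Scope ring_scope.
Variables (R : comNzRingType) (S : idomainType) (phi : {rmorphism R -> S}).

Lemma kernel_is_prime : is_prime_ideal [set f | phi f = 0]%classic.
Proof.
split; first split.
- by rewrite inE /= rmorph0.
- by apply/negP; rewrite inE /= rmorph1 => /eqP; rewrite oner_eq0.
- by move=> a u v; rewrite !inE /= rmorphD rmorphM => -> ->; rewrite mulr0 addr0.
move=> u v; rewrite inE /= rmorphM => /eqP; rewrite mulf_eq0.
by case/orP => /eqP phi0; apply/orP; [left|right]; rewrite inE.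
Qed.

Lemma kernel_is_radical f m : phi (f ^+ m) = 0 -> phi f = 0.
Proof. by rewrite rmorphXn => /eqP; rewrite expf_eq0 => /andP[_ /eqP]. Qed.

End Kernel.

(** * Monomials as multisets, and setting indeterminates to 0 *)

Section Monomials.
Import GRing.Theory.
Local Open Scope ring_scope.
Variables (k : fieldType) (T : finType).
Implicit Types (u v : seq T) (m : 'X_{1..#|{: T}|}).

Definition mnm_seq u : 'X_{1..#|{: T}|} := (\sum_(x <- u) U_(enum_rank x))%MM.

Definition seq_mnm m : seq T :=
  flatten [seq nseq (m i) (enum_val i) | i <- enum 'I_#|{: T}|].

Lemma seq_mnmK m : mnm_seq (seq_mnm m) = m.
Proof.
rewrite /mnm_seq big_flatten big_map big_enum /= [RHS]multinomUE_id; apply: eq_bigr => i _.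
by rewrite big_nseq enum_valK; elim: (m i) => [|j IHj]; rewrite ?mulm0n // mulmS /= IHj.
Qed.

Lemma mpolyX_seq u : \prod_(x <- u) indet k x = 'X_[mnm_seq u].
Proof. exact: mprodXE. Qed.

(* F is a sum of differences of monomials in the same fibre of [mu], since
   its coefficients add up to 0 on each fibre. *)
Lemma ideal_of_fibers (G : set (mpoly_on k T)) (a : nat)
    (mu : 'X_{1..#|{: T}|} -> 'X_{1..a}) (F : mpoly_on k T) :
    \sum_(m <- msupp F) F@_m *: 'X_[mu m] = 0 :> {mpoly k[a]} ->
    (forall m m', m \in msupp F -> m' \in msupp F -> mu m = mu m' ->
       ideal_gen G ('X_[m] - 'X_[m'])) ->
  ideal_gen G F.
Proof.
move=> sum0 fibG.
(* A representative of each fibre that meets the support; the default is irrelevant for images of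
   monomials in the support. *)
pose rep t := head 0%MM [seq m <- msupp F | mu m == t].
have repP m : m \in msupp F -> rep (mu m) \in msupp F /\ mu m = mu (rep (mu m)).
  move=> mF; rewrite /rep.
  have : all (fun m' => (mu m' == mu m) && (m' \in msupp F)) [seq m' <- msupp F | mu m' == mu m].
    by apply/allP => m'; rewrite mem_filter.
  have : m \in [seq m' <- msupp F | mu m' == mu m] by rewrite mem_filter eqxx.
  by case: [seq _ <- _ | _] => //= m' s _ /andP[/andP[/eqP-> ->]].
(* Grouped by fibre, the factor of each representative is a coefficient of the vanishing image of
   F. *)
have zero : \sum_(m <- msupp F) F@_m *: 'X_[rep (mu m)] = 0 :> mpoly_on k T.
  transitivity (\sum_(m <- msupp F) \sum_(t <- undup [seq mu m' | m' <- msupp F])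
      (F@_m * (mu m == t)%:R) *: 'X_[rep t] : mpoly_on k T).
    rewrite big_seq [RHS]big_seq; apply: eq_bigr => m mF.
    rewrite (bigD1_seq (mu m)) ?undup_uniq ?mem_undup ?map_f //= eqxx mulr1 big1 ?addr0 //.
    by move=> t; rewrite eq_sym => /negbTE->; rewrite mulr0 scale0r.
  rewrite exchange_big big1 //= => t _; rewrite -scaler_suml.
  have sum_t : \sum_(m <- msupp F) F@_m * (mu m == t)%:R = 0.
    have := congr1 (mcoeff t) sum0; rewrite mcoeff0 raddf_sum /= => sum0t; rewrite -[RHS]sum0t.
    apply: eq_bigr => m _.
    by rewrite mcoeffZ mcoeffX.
  by rewrite sum_t scale0r.
have -> : F = \sum_(m <- msupp F) F@_m *: ('X_[m] - 'X_[rep (mu m)]).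
  under eq_bigr do rewrite scalerBr.
  by rewrite sumrB zero subr0; exact: mpolyE.
apply: ideal_gen_sum => m mF.
by rewrite -mul_mpolyC; apply/ideal_genM/fibG => //; have [] := repP m mF.
Qed.

Section Kill.
Variable keep : pred T.

Definition kill_fun (i : 'I_#|{: T}|) : mpoly_on k T := if keep (enum_val i) then 'X_i else 0.

Definition kill : {rmorphism mpoly_on k T -> mpoly_on k T} :=
  mmap (@mpolyC _ k) kill_fun.

Lemma kill_indet x : kill (indet k x) = if keep x then indet k x else 0.
Proof. by rewrite /kill /= mmapX mmap1U /kill_fun enum_rankK. Qed.

Lemma kill_seq u : kill (\prod_(x <- u) indet k x) =
  if all keep u then \prod_(x <- u) indet k x else 0.
Proof.
rewrite rmorph_prod; elim: u => [|x u IHu]; first by rewrite !big_nil.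
by rewrite !big_cons IHu kill_indet /=; case: (keep x); case: (all _ _); rewrite /= ?mul0r ?mulr0.
Qed.

Lemma kill_mnm m : kill 'X_[m] = if all keep (seq_mnm m) then 'X_[m] else 0.
Proof. by have := kill_seq (seq_mnm m); rewrite mpolyX_seq seq_mnmK. Qed.

Lemma kill_coef F m : all keep (seq_mnm m) -> (kill F)@_m = F@_m.
Proof.
move=> keep_m; rewrite [in LHS](mpolyE F) rmorph_sum raddf_sum /=.
rewrite [in RHS](mpolyE F) [RHS]raddf_sum /=; apply: eq_bigr => m' _.
rewrite -/(kill _) -mul_mpolyC rmorphM /= mmapC !mul_mpolyC !mcoeffZ; congr (_ * _).
rewrite -/(kill _) kill_mnm; case: ifP => // not_keep; rewrite mcoeff0 mcoeffX.
by case: eqP => // eq_m; rewrite eq_m keep_m in not_keep.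
Qed.

(** Modulo the killed indeterminates every polynomial is congruent to its image under [kill]. This
    presents the monomial ideal as a kernel, from which primality follows. *)
Lemma kill_ideal (F : mpoly_on k T) :
  ideal_gen [set g | exists2 x, g = indet k x & ~~ keep x]%classic F <-> kill F = 0.
Proof.
set G := (X in ideal_gen X _); split.
  by apply: ideal_gen_sub => g [x -> /negbTE not_keep]; rewrite kill_indet not_keep.
move=> kill0; suff : fixed_mod G kill F by rewrite /fixed_mod kill0 subr0.
rewrite (mpolyE F); apply: (fixed_mod_sum (phi := kill)) => m.
rewrite -mul_mpolyC; apply: fixed_modM.
  by apply: fixed_mod_eq; rewrite /= mmapC.
have := mpolyX_seq (seq_mnm m); rewrite seq_mnmK => <-.
apply: (fixed_mod_prod (phi := kill)) => x.
rewrite /fixed_mod kill_indet; case: ifP => [_|not_keep]; first by rewrite subrr; exact: ideal_gen0.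
by rewrite subr0; apply: ideal_gen_incl; exists x; rewrite // not_keep.
Qed.

End Kill.

Lemma indet_divides_prod (x : T) u :
  divides (indet k x) (\prod_(y <- u) indet k y) <-> x \in u.
Proof.
split=> [[q eq_q]|xu]; last first.
  by exists (\prod_(y <- rem x u) indet k y); rewrite (perm_big _ (perm_to_rem xu)) big_cons mulrC.
(* Setting [x] to 0 kills the multiple of [x] but fixes a product that does not involve it. *)
apply: contraT => not_xu; have := congr1 (kill (predC1 x)) eq_q.
rewrite rmorphM kill_indet /= eqxx mulr0 kill_seq.
have -> : all (predC1 x) u by apply/allP => y yu; apply: contraNneq not_xu => <-.
rewrite mpolyX_seq => /(congr1 (mcoeff (mnm_seq u))).
by rewrite mcoeffX eqxx mcoeff0 => /eqP; rewrite oner_eq0.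
Qed.

End Monomials.

(** * Separators, arcs and the eight states of a quartic *)

Section Separation.
Variable N : nat.
Implicit Types (A B C W S : {set 'I_N}) (x y a b c : state N).

Lemma separates_of_adj C A B : [disjoint A & B] ->
    (forall u v : 'I_N, u \in A -> cycle_adj u v -> (v \in A) || (v \in C)) ->
  separates C A B.
Proof.
move=> dAB adjA u s uA path_s _; elim: s u uA path_s => [|v s IHs] u uA /=.
  by move=> _ uB; rewrite (disjointFr dAB uA) in uB.
move=> /andP[uv path_s] last_s; have [vA|vC] := orP (adjA u v uA uv).
  by have := IHs v vA path_s last_s => /= ->; rewrite orbT.
by rewrite [in_mem v _]vC orbT.
Qed.

Lemma separates_clique C A B W : is_partition3 A B C -> separates C A B -> is_clique W ->
  [disjoint W & A] \/ [disjoint W & B].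
Proof.
move=> [_ dAB dAC dBC] sep /forallP cl.
case: (boolP [disjoint W & A]) => [|/pred0Pn[u /andP[/= uW uA]]]; [by left|right].
apply/pred0P => v /=; apply/negP => /andP[vW vB].
have neq_uv : u != v by apply: contraTneq vB => <-; rewrite (disjointFr dAB uA).
have := implyP (cl u) uW => /forallP/(_ v)/implyP/(_ vW)/implyP/(_ neq_uv) adj.
have path_uv : path (@cycle_adj N) u [:: v] by rewrite /= adj.
have uniq_uv : uniq [:: u; v] by rewrite /= inE neq_uv.
have /hasP[z] := sep u [:: v] uA path_uv uniq_uv vB.
rewrite !inE => /orP[] /eqP-> /= zC.
  by rewrite [_ \in C](disjointFr dAC uA) in zC.
by rewrite [_ \in C](disjointFr dBC vB) in zC.
Qed.

(** Only the last vertex of the sequence that traces the arc can have its successor outside. *)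
Lemma arc_exit W (v v' : 'I_N) : is_arc W -> v \in W -> v' \in W ->
  ordS v \notin W -> ordS v' \notin W -> v = v'.
Proof.
move=> [u [l ->]].
have exit (z : 'I_N) : z \in [set v in traject (@ordS N) u l]%SET ->
    ordS z \notin [set v in traject (@ordS N) u l]%SET -> z = iter l.-1 (@ordS N) u.
  rewrite !inE => /trajectP[i lt_il ->]; rewrite -iterS => out.
  have -> // : i = l.-1.
  apply/eqP; rewrite -eqSS (ltn_predK lt_il) eqn_leq lt_il leqNgt.
  by apply: contra out => lt_i1; apply/trajectP; exists i.+1.
move=> vW v'W vout v'out; have eq_v := exit _ vW vout; have eq_v' := exit _ v'W v'out.
exact: etrans eq_v (esym eq_v').
Qed.

Lemma glue_eq A B a b c x :
  (forall v, v \in A -> a v = x v) -> (forall v, v \in B -> b v = x v) ->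
  (forall v, v \notin A -> v \notin B -> c v = x v) -> glue A B a b c = x.
Proof.
move=> ax bx cx; apply/ffunP => v; rewrite ffunE.
by case: ifPn => [/ax//|vA]; case: ifPn => [/bx//|vB]; apply: cx.
Qed.

Definition flip_if (e : bool) x : state N := if e then flip x else x.

Lemma flip_ifE e x v : flip_if e x v = e (+) x v.
Proof. by case: e; rewrite /flip_if //= ffunE. Qed.

Definition cube S1 S2 a b c x :=
  exists e1 e2 e3, x = glue S1 S2 (flip_if e1 a) (flip_if e2 b) (flip_if e3 c).

Definition even_corners S1 S2 a b c : seq (state N) :=
  [:: glue S1 S2 a b c; glue S1 S2 a (flip b) (flip c);
      glue S1 S2 (flip a) b (flip c); glue S1 S2 (flip a) (flip b) c].

Definition odd_corners S1 S2 a b c : seq (state N) :=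
  [:: glue S1 S2 a b (flip c); glue S1 S2 a (flip b) c;
      glue S1 S2 (flip a) b c; glue S1 S2 (flip a) (flip b) (flip c)].

Lemma mem_corners S1 S2 a b c x :
  x \in even_corners S1 S2 a b c ++ odd_corners S1 S2 a b c <-> cube S1 S2 a b c x.
Proof.
split; last by move=> [[] [[] [[] ->]]]; rewrite !inE eqxx ?orbT.
rewrite mem_cat !inE => /orP[] /or4P[] /eqP->.
- by exists false, false, false.
- by exists false, true, true.
- by exists true, false, true.
- by exists true, true, false.
- by exists false, false, true.
- by exists false, true, false.
- by exists true, false, false.
- by exists true, true, true.
Qed.

End Separation.

(** * Walks around the cycle *)

Lemma nat_change (d : nat -> bool) i j : i < j -> d i != d j ->
  exists2 t, i <= t < j & d t != d t.+1.
Proof.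
elim: j => // j IHj; rewrite ltnS leq_eqVlt => /orP[/eqP->|lt_ij] neq.
  by exists j; rewrite ?leqnn.
have [eq_j|neq_j] := eqVneq (d j) (d j.+1); last by exists j; rewrite // ltnW /=.
rewrite -eq_j in neq; have [t /andP[le_it lt_tj] dt] := IHj lt_ij neq.
by exists t; rewrite // le_it ltnW.
Qed.

Lemma path_map_iota (T : Type) (e : rel T) (g : nat -> T) m :
  (forall j, j < m -> e (g j) (g j.+1)) -> path e (g 0) [seq g j.+1 | j <- iota 0 m].
Proof.
move=> eg; suff H i : i <= m -> path e (g (m - i)) [seq g j.+1 | j <- iota (m - i) i].
  by have := H m (leqnn m); rewrite subnn.
elim: i => //= i IHi lt_im; rewrite eg /=; last by lia.
by have -> : (m - i.+1).+1 = m - i by [lia]; apply/IHi/ltnW.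
Qed.

Section CyclicShift.
Variable n : nat.
Local Notation N := n.+1.
Implicit Types (A B C S : {set 'I_N}) (x y a b c : state N) (u w : 'I_N).

Definition cyc u t : 'I_N := inord ((u + t) %% N).

Lemma val_cyc u t : cyc u t = (u + t) %% N :> nat.
Proof. by rewrite inordK ?ltn_pmod. Qed.

Lemma cyc0 u : cyc u 0 = u.
Proof. by apply: val_inj; rewrite /= val_cyc addn0 modn_small. Qed.

Lemma cycN u : cyc u N = u.
Proof. by apply: val_inj; rewrite /= val_cyc modnDr modn_small. Qed.

Lemma ordS_cyc u t : ordS (cyc u t) = cyc u t.+1.
Proof. by apply: val_inj; rewrite /= !val_cyc -addn1 modnDml addn1 addnS. Qed.

Lemma cyc_inj u i j : i < N -> j < N -> cyc u i = cyc u j -> i = j.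
Proof.
move=> lt_i lt_j /(congr1 val) /=; rewrite !val_cyc => /eqP.
by rewrite eqn_modDl !modn_small // => /eqP.
Qed.

Lemma cyc_surj u w : exists2 t, t < N & w = cyc u t.
Proof.
exists ((w + (N - u)) %% N); first exact: ltn_pmod.
apply: val_inj; rewrite /= val_cyc modnDmr addnCA subnKC; last exact: ltnW.
by rewrite modnDr modn_small.
Qed.

(** The two ways around the cycle from u to its t-th successor are both paths, so each of them meets
    C. *)
Lemma separates_cyc C A B u t : separates C A B -> u \in A -> cyc u t \in B -> 0 < t < N ->
  (exists2 i, i <= t & cyc u i \in C) /\ (exists2 i, t <= i <= N & cyc u i \in C).
Proof.
move=> sep uA wB /andP[t_gt0 lt_tN].
have adjS i : cycle_adj (cyc u i) (cyc u i.+1) by rewrite /cycle_adj /= ordS_cyc eqxx.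
have adjP i : cycle_adj (cyc u i.+1) (cyc u i) by rewrite /cycle_adj /= !ordS_cyc eqxx orbT.
have meet (g : nat -> nat) m : 0 < m -> cyc u (g 0) = u -> g m = t ->
    (forall j, j < m -> cycle_adj (cyc u (g j)) (cyc u (g j.+1))) ->
    {in [pred j | j <= m] &, injective (fun j => cyc u (g j))} ->
    exists2 j, j <= m & cyc u (g j) \in C.
  move=> m_gt0 g0 gm adj inj.
  have mapS : cyc u (g 0) :: [seq cyc u (g j.+1) | j <- iota 0 m] = [seq cyc u (g j) | j <- iota 0 m.+1].
    by rewrite /= (iotaDl 1 0 m) -map_comp.
  have path_g : path (@cycle_adj N) u [seq cyc u (g j.+1) | j <- iota 0 m].
    by rewrite -{1}g0; apply: (@path_map_iota _ _ (fun j => cyc u (g j))).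
  have consE : u :: [seq cyc u (g j.+1) | j <- iota 0 m] = [seq cyc u (g j) | j <- iota 0 m.+1].
    by rewrite -{1}g0 -mapS.
  have uniq_g : uniq (u :: [seq cyc u (g j.+1) | j <- iota 0 m]).
    rewrite consE map_inj_in_uniq ?iota_uniq // => i j; rewrite !mem_iota /= !add0n !ltnS.
    exact: inj.
  have last_g : last u [seq cyc u (g j.+1) | j <- iota 0 m] \in B.
    by rewrite -[m in iota 0 m](prednK m_gt0) -[m.-1.+1]addn1 iotaD map_cat last_cat /= add0n prednK // gm.
  have /hasP[z] := sep u _ uA path_g uniq_g last_g.
  by rewrite consE => /mapP[j]; rewrite mem_iota add0n ltnS => le_j -> jC; exists j.
split.
  apply: (@meet id) => //; first exact: cyc0.
  by move=> i j; rewrite !inE => le_i le_j; apply: cyc_inj; apply: leq_ltn_trans lt_tN.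
have [|||j lt_j|i j|i le_i Ci] := @meet (fun j => N - j) (N - t).
- by rewrite subn_gt0.
- by rewrite subn0 cycN.
- by rewrite subKn // ltnW.
- have -> : N - j = (N - j.+1).+1 by clear -lt_j lt_tN; lia.
  exact: adjP.
- rewrite !inE => le_i le_j eq_ij.
  case: (posnP i) (posnP j) eq_ij => [->|i_gt0] [->|j_gt0] //.
  + rewrite subn0 cycN -{1}[u]cyc0 => /cyc_inj; lia.
  + rewrite subn0 cycN -{2}[u]cyc0 => /cyc_inj; lia.
  + move/cyc_inj; lia.
exists (N - i) => //; lia.
Qed.

(** The set where [x] and [y] differ is a union of some of the three arcs. If it met both A and B,
    it would be left and entered twice on the way around, since C meets both ways between them. Each
    of these four changes happens at the exit of an arc, but three arcs have at most three exits. *)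
Lemma cube_separated S1 S2 S3 A B C a b c x y :
    is_partition3 S1 S2 S3 -> [/\ is_arc S1, is_arc S2 & is_arc S3] ->
    is_partition3 A B C -> separates C A B ->
    cube S1 S2 a b c x -> cube S1 S2 a b c y -> {in C, x =1 y} ->
  {in A, x =1 y} \/ {in B, x =1 y}.
Proof.
move=> [cov d12 d13 d23] [arc1 arc2 arc3] [_ dAB dAC dBC] sep
  [e1 [e2 [e3 xE]]] [e1' [e2' [e3' yE]]] eqC.
have [|nA] := pselect {in A, x =1 y}; [by left|right=> w wB; apply/eqP/negP => /negP dw].
case: nA => u uA; apply/eqP/negP => /negP du.
pose d v := x v != y v.
pose cl (v : 'I_N) := if v \in S1 then 0 else if v \in S2 then 1 else 2.
have mem1 v : (v \in S1) = (cl v == 0) by rewrite /cl; case: ifP => // _; case: ifP.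
have mem2 v : (v \in S2) = (cl v == 1).
  by rewrite /cl; case: ifP => [/(disjointFr d12)->//|_]; case: ifP.
have mem3 v : (v \in S3) = (cl v == 2).
  rewrite /cl; case: ifP => [/(disjointFr d13)->//|v1].
  case: ifP => [/(disjointFr d23)->//|v2].
  have := finset.in_setT v; rewrite -cov !finset.in_setU v1 v2 /= => ->.
  by [].
have d_cl v v' : cl v = cl v' -> d v = d v'.
  have dE z : d z = if cl z == 0 then e1 != e1' else if cl z == 1 then e2 != e2' else e3 != e3'.
    rewrite /d xE yE !ffunE /cl; case: ifP => _; last case: ifP => _; rewrite !flip_ifE /=.
    - by case: (a z); case: (e1); case: (e1').
    - by case: (b z); case: (e2); case: (e2').
    - by case: (c z); case: (e3); case: (e3').
  by rewrite !dE => ->.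
have cl_exit v v' : cl v = cl v' -> d v != d (ordS v) -> d v' != d (ordS v') -> v = v'.
  have out z : d z != d (ordS z) -> cl (ordS z) != cl z.
    by apply: contra => /eqP/d_cl->.
  move=> eq_cl /out ne_v /out; rewrite -eq_cl => ne_v'.
  have : cl v \in [:: 0; 1; 2] by rewrite /cl; case: ifP => // _; case: ifP.
  rewrite !inE => /or3P[] /eqP cl_v; move: ne_v ne_v' eq_cl; rewrite cl_v => ne_v ne_v' /esym cl_v'.
  - by apply: (arc_exit arc1); rewrite mem1 ?cl_v ?cl_v'.
  - by apply: (arc_exit arc2); rewrite mem2 ?cl_v ?cl_v'.
  - by apply: (arc_exit arc3); rewrite mem3 ?cl_v ?cl_v'.
have [t lt_tN wt] := cyc_surj u w; rewrite {}wt in wB dw.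
have t_gt0 : 0 < t.
  by rewrite lt0n; apply: contraTneq wB => ->; rewrite cyc0 (disjointFr dAB uA).
have dC v : v \in C -> d v = false by move=> vC; rewrite /d eqC // eqxx.
have [|[i le_i iC] [j /andP[le_j le_jN] jC]] := separates_cyc sep uA wB.
  by rewrite t_gt0.
have dR0 : d (cyc u 0) by rewrite cyc0.
have dRN : d (cyc u N) by rewrite cycN.
have dRt : d (cyc u t) by [].
have di := dC _ iC; have dj := dC _ jC.
have i_gt0 : 0 < i by rewrite lt0n; apply: contraFneq di => ->.
have lt_it : i < t by rewrite ltn_neqAle le_i andbT; apply: contraFneq di => ->.
have lt_tj : t < j by rewrite ltn_neqAle le_j andbT eq_sym; apply: contraFneq dj => ->.
have lt_jN : j < N by rewrite ltn_neqAle le_jN andbT; apply: contraFneq dj => ->.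
have change := @nat_change (fun i => d (cyc u i)).
have [|k1 /andP[_ k1i] x1] := change _ _ i_gt0; first by rewrite dR0 di.
have [|k2 /andP[ik2 k2t] x2] := change _ _ lt_it; first by rewrite dRt di.
have [|k3 /andP[tk3 k3j] x3] := change _ _ lt_tj; first by rewrite dRt dj.
have [|k4 /andP[jk4 k4N] x4] := change _ _ lt_jN; first by rewrite dRN dj.
rewrite -!ordS_cyc in x1 x2 x3 x4.
have uniq_cl : uniq [seq cl v | v <- [:: cyc u k1; cyc u k2; cyc u k3; cyc u k4]].
  rewrite map_inj_in_uniq; last first.
    move=> v v' vl v'l eq_cl; apply: (cl_exit v v' eq_cl).
      by move: vl; rewrite !inE => /or4P[] /eqP->.
    by move: v'l; rewrite !inE => /or4P[] /eqP->.
  have neq k k' : k < k' -> k' < N -> cyc u k != cyc u k'.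
    move=> lt_k lt_k'; apply/eqP => /(cyc_inj (ltn_trans lt_k lt_k') lt_k') eq_k.
    by rewrite eq_k ltnn in lt_k.
  have k12 := leq_trans k1i ik2; have k23 := leq_trans k2t tk3.
  have k34 := leq_trans k3j jk4; have k13 := ltn_trans k12 k23.
  have k24 := ltn_trans k23 k34; have k14 := ltn_trans k13 k34.
  have k3N := ltn_trans k34 k4N; have k2N := ltn_trans k23 k3N.
  by rewrite /= !inE !negb_or !neq.
have sub_cl : {subset [seq cl v | v <- [:: cyc u k1; cyc u k2; cyc u k3; cyc u k4]] <= iota 0 3}.
  by move=> _ /mapP[v _ ->]; rewrite /cl; case: ifP => _ //; case: ifP.
by have := uniq_leq_size uniq_cl sub_cl.
Qed.

End CyclicShift.

(** * The global Markov ideal and the toric map *)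

Section GlobalMarkov.
Import GRing.Theory.
Local Open Scope ring_scope.
Variables (k : fieldType) (n : nat).
Local Notation N := n.+1.
Implicit Types (x y : state N) (u v : seq (state N)).
Local Notation p := (@indet k (state N)).
Local Notation monom u := (\prod_(x <- u) p x).

Lemma swap_markov i j x y : (i < j <= N)%N -> bit x i = bit y i -> bit x j = bit y j ->
  global_markov_binomials (p x * p y - p (swap i j x y) * p (swap i j y x)).
Proof.
move=> /andP[lt_ij le_j] eqi eqj.
pose A : {set 'I_N} := [set w : 'I_N | (i < w < j)%N]%SET.
(* The separator consists of the two ends of the segment; the reduction modulo N covers j = N. *)
pose C : {set 'I_N} := [set w : 'I_N | ((w == i :> nat) || (w == j %% N :> nat))%N]%SET.
pose B : {set 'I_N} := (~: (A :|: C))%SET.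
have dAC : [disjoint A & C].
  apply/pred0P => w; rewrite /= !inE; apply/negP => /andP[/andP[iw wj] /orP[/eqP wi|/eqP wjN]].
    by rewrite wi ltnn in iw.
  have [eq_jN|neq_jN] := eqVneq j N; first by rewrite wjN eq_jN modnn in iw.
  by rewrite wjN modn_small ?ltnn // in wj; rewrite ltn_neqAle neq_jN.
have dAB : [disjoint A & B].
  by apply/pred0P => w; rewrite /= !inE; case: (i < w < j)%N.
have dBC : [disjoint B & C].
  by apply/pred0P => w; rewrite /= !inE; case: (w == i :> nat); case: (w == _ :> nat); rewrite ?orbT ?andbF.
have eqC w : w \in C -> x w = y w.
  rewrite inE -!bit_ord => /orP[/eqP->//|/eqP->].
  by rewrite /bit !modn_mod; exact: eqj.
have notAB w : w \notin A -> w \notin B -> x w = y w.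
  by move=> wA wB; apply: eqC; move: wA wB; rewrite [w \in B]finset.in_setC finset.in_setU negbK => /negbTE->.
exists A, B, C; split.
- split=> //; apply/setP => w; rewrite !inE.
  by case: (i < w < j)%N; case: (w == i :> nat); case: (w == _ :> nat).
- apply: separates_of_adj => // w w'; rewrite !inE => /andP[iw wj] /orP[] /eqP eq_w.
    have lt_w := ltn_ord w; have eqv : w' = (w.+1 %% N)%N :> nat by rewrite -eq_w.
    have [lt_wN|ge_wN] := ltnP w.+1 N; last first.
      have jN : j = N by clear -ge_wN wj le_j; lia.
      by rewrite eqv jN (_ : w.+1 = N) ?eqxx ?orbT //; clear -ge_wN lt_w; lia.
    rewrite modn_small // in eqv; rewrite eqv.
    have [lt_wj|ge_wj] := ltnP w.+1 j; first by rewrite (ltn_trans iw).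
    have -> : j = w.+1 by clear -ge_wj wj; lia.
    by rewrite modn_small // eqxx !orbT.
  have lt_w' := ltn_ord w'; have eqv : w = (w'.+1 %% N)%N :> nat by rewrite -eq_w.
  have [lt_wN|ge_wN] := ltnP w'.+1 N; last first.
    by move: iw; rewrite eqv (_ : w'.+1 = N) ?modnn //; clear -ge_wN lt_w'; lia.
  rewrite modn_small // in eqv; clear -eqv iw wj; rewrite eqv in iw wj.
  have [->|neq] := eqVneq (w' : nat) i; first by rewrite orbT.
  by rewrite ltn_neqAle eq_sym neq -ltnS iw (ltnW wj).
exists x, y, x, y, x.
have <- : swap i j x y = glue A B y x x.
  apply/ffunP => w; rewrite !ffunE !inE !bit_ord.
  by case: ifP => // _; case: ifP.
have <- : x = glue A B x x x by apply/esym/glue_eq.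
have <- : y = glue A B y y x by apply/esym/glue_eq => // w wA wB; exact: notAB.
have <- : swap i j y x = glue A B x y x.
  apply/esym/glue_eq => w; rewrite ffunE !bit_ord ?inE; first by move=> ->.
    by move=> /norP[/negbTE->].
  by move=> wA wB; rewrite (negbTE wA); apply: notAB; rewrite ?inE.
by rewrite [p (swap i j y x) * _]mulrC.
Qed.

Lemma conn_global_markov u v : conn u v -> global_markov_ideal k N (monom u - monom v).
Proof.
elim=> {u v} [u v eq_uv|i j x y u lt_ij le_j eqi eqj|u v w _ uv _ vw].
- by rewrite (perm_big _ eq_uv) subrr; exact: ideal_gen0.
- rewrite !big_cons !mulrA -mulrBl mulrC; apply/ideal_genM/ideal_gen_incl/swap_markov => //.
  by rewrite lt_ij.
- by rewrite -(subrK (monom v) (monom u)) -addrA; apply: ideal_genD.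
Qed.

Definition toric_rmorph : {rmorphism mpoly_on k (state N) -> mpoly_on k (param N)} :=
  mmap (@mpolyC _ k) (fun i => toric_param k (enum_val i)).

Lemma toric_indet x : toric_rmorph (p x) = toric_param k x.
Proof. by rewrite /toric_rmorph /= mmapX mmap1U enum_rankK. Qed.

(** A clique misses A or B, so for each clique the two terms give the same two factors, possibly
    interchanged. *)
Lemma global_markov_toric f : global_markov_binomials f -> toric_rmorph f = 0.
Proof.
move=> [A [B [C [part sep [a [a' [b [b' [c ->]]]]]]]]].
rewrite rmorphB !rmorphM !toric_indet -!big_split /=; apply/eqP; rewrite subr_eq0; apply/eqP.
apply: eq_bigr => W _.
have restr_eq (x y : state N) : {in val W, x =1 y} -> restr (val W) x = restr (val W) y.
  by move=> eq_xy; apply/ffunP => z; rewrite !ffunE; apply/eq_xy/(valP z).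
have [dA|dB] := separates_clique part sep (valP W).
  rewrite (restr_eq (glue A B a b c) (glue A B a' b c)) 1?(restr_eq (glue A B a' b' c) (glue A B a b' c)) 1?mulrC //;
    by move=> z zW; rewrite !ffunE (disjointFr dA zW).
rewrite (restr_eq (glue A B a b c) (glue A B a b' c)) 1?(restr_eq (glue A B a' b' c) (glue A B a' b c)) //;
  by move=> z zW; rewrite !ffunE (disjointFr dB zW).
Qed.

Definition mnm_toric x : 'X_{1..#|{: param N}|} :=
  (\sum_(W : clique N) U_(enum_rank (existT _ W (restr (val W) x) : param N)))%MM.

Definition mnm_fiber (m : 'X_{1..#|{: state N}|}) := (\sum_(x <- seq_mnm m) mnm_toric x)%MM.

Lemma toric_mnm m : toric_rmorph 'X_[m] = 'X_[mnm_fiber m].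
Proof.
have := mpolyX_seq k (seq_mnm m); rewrite seq_mnmK => <-.
rewrite rmorph_prod -mprodXE; apply: eq_bigr => x _.
by rewrite toric_indet /toric_param /mnm_toric -mprodXE.
Qed.

Lemma mnm_fiber_count m (W : clique N) z :
  mnm_fiber m (enum_rank (existT _ W (restr (val W) z) : param N)) =
  count (fun x => restr (val W) x == restr (val W) z) (seq_mnm m).
Proof.
rewrite /mnm_fiber mnm_sumE -sum1_count [RHS]big_mkcond; apply: eq_bigr => x _ /=.
rewrite /mnm_toric mnm_sumE (bigD1 W) //= big1 ?addn0 => [|V neq_V].
  by rewrite mnm1E (inj_eq enum_rank_inj) eq_Tagged /=; case: (_ == _).
rewrite mnm1E (inj_eq enum_rank_inj); case: eqP => // /(congr1 (@tag _ _)) /= eq_V.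
by rewrite eq_V eqxx in neq_V.
Qed.

(** Edges are cliques, and the exponent of an indeterminate belonging to an edge is the number of
    rows with the given bits on it. *)
Lemma fiber_Eeq m m' : (0 < n)%N -> mnm_fiber m = mnm_fiber m' ->
  Eeq (seq_mnm m) (seq_mnm m').
Proof.
move=> n_gt0 eq_mm' l a b lt_l.
pose v : 'I_N := inord l; pose v' := ordS v.
have v_l : v = l :> nat by rewrite inordK.
have v'_l : v' = (l.+1 %% N)%N :> nat by rewrite /= v_l.
have neq_v : v' != v.
  apply/eqP => /(congr1 val) /=; rewrite v_l.
  have [lt_l1|ge_l1] := ltnP l.+1 N; first by rewrite modn_small //; clear; lia.
  have -> : l.+1 = N by clear -ge_l1 lt_l; lia.
  by rewrite modnn => l0; clear -l0 ge_l1 n_gt0; lia.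
have clW : is_clique [set v; v']%SET.
  apply/forallP => w; apply/implyP; rewrite !inE => /orP[] /eqP->;
  apply/forallP => w'; apply/implyP; rewrite !inE => /orP[] /eqP->;
  by rewrite ?eqxx //; apply/implyP => _; rewrite /cycle_adj /= -/v' eqxx ?orbT.
pose W : clique N := exist (fun W : {set 'I_N} => is_true (is_clique W)) _ clW.
pose z : state N := [ffun w => if w == v then a else b].
have edgeE x : edge l a b x = (restr (val W) x == restr (val W) z).
  have vW : v \in val W by rewrite !inE eqxx.
  have v'W : v' \in val W by rewrite !inE eqxx orbT.
  have -> : edge l a b x = (x v == a) && (x v' == b).
    rewrite /edge -!bit_ord v_l v'_l; congr (_ && (_ == _)).
    by rewrite /bit modn_mod.
  apply/andP/eqP => [[/eqP xv /eqP xv']|eq_r].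
    apply/ffunP => -[w wW]; rewrite !ffunE /=.
    by move: wW; rewrite !inE => /orP[] /eqP->; rewrite ?eqxx // (negbTE neq_v).
  move/ffunP: eq_r => eq_r.
  have := eq_r (exist (fun w => is_true (w \in val W)) v vW).
  have := eq_r (exist (fun w => is_true (w \in val W)) v' v'W).
  by rewrite !ffunE /= eqxx (negbTE neq_v) => -> ->.
by rewrite !(eq_count edgeE) -!mnm_fiber_count eq_mm'.
Qed.

End GlobalMarkov.

(** * The monomial primes of the quartics *)

Section QuarticPrimes.
Import GRing.Theory.
Local Open Scope ring_scope.
Variables (k : fieldType) (n : nat).
Local Notation N := n.+1.
Implicit Types (x y : state N) (u v : seq (state N)).
Local Notation p := (@indet k (state N)).
Local Notation monom u := (\prod_(x <- u) p x).

Section Quartics.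
Variables (S1 S2 S3 : {set 'I_N}) (a b c : state N).

Definition in_cube : pred (state N) :=
  fun x => x \in even_corners S1 S2 a b c ++ odd_corners S1 S2 a b c.

Definition quartic : mpoly_on k (state N) * mpoly_on k (state N) :=
  (monom (even_corners S1 S2 a b c), monom (odd_corners S1 S2 a b c)).

Lemma monomial_prime_kill f : monomial_prime quartic f <-> kill k in_cube f = 0.
Proof.
rewrite -kill_ideal /monomial_prime.
suff -> : [set g | exists x, [/\ g = p x, ~ divides (p x) quartic.1 & ~ divides (p x) quartic.2]]%classic
  = [set g | exists2 x, g = p x & ~~ in_cube x]%classic by [].
apply/seteqP; split=> g [x].
  move=> [-> n1 n2]; exists x => //; rewrite /in_cube mem_cat; apply/norP.
  by split; apply/negP => x_in; [apply: n1|apply: n2]; apply/indet_divides_prod.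
move=> ->; rewrite /in_cube mem_cat => /norP[n1 n2]; exists x; split=> //.
  by move=> /indet_divides_prod; apply/negP.
by move=> /indet_divides_prod; apply/negP.
Qed.

Hypothesis part : is_partition3 S1 S2 S3.
Hypothesis arcs : [/\ is_arc S1, is_arc S2 & is_arc S3].

(** If both variables of one term survive, [cube_separated] shows that the two terms are equal;
    otherwise both terms are killed. *)
Lemma global_markov_kill f : global_markov_binomials f -> kill k in_cube f = 0.
Proof.
move=> [A [B [C [partABC sep [d [d' [e [e' [g ->]]]]]]]]].
have swap_glue (d1 d2 e1 e2 : state N) :
    in_cube (glue A B d1 e1 g) -> in_cube (glue A B d2 e2 g) ->
    p (glue A B d1 e1 g) * p (glue A B d2 e2 g) = p (glue A B d1 e2 g) * p (glue A B d2 e1 g).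
  move=> /mem_corners in1 /mem_corners in2; have [_ dAB dAC dBC] := partABC.
  have eqC : {in C, glue A B d1 e1 g =1 glue A B d2 e2 g}.
    by move=> w wC; rewrite !ffunE (disjointFl dAC wC) (disjointFl dBC wC).
  have [eqA|eqB] := cube_separated part arcs partABC sep in1 in2 eqC.
    have eqd w : w \in A -> d1 w = d2 w by move=> wA; have := eqA w wA; rewrite !ffunE wA.
    have -> : glue A B d1 e2 g = glue A B d2 e2 g.
      by apply/ffunP => w; rewrite !ffunE; case: ifP => // /eqd.
    have -> : glue A B d2 e1 g = glue A B d1 e1 g.
      by apply/ffunP => w; rewrite !ffunE; case: ifP => // /eqd.
    exact: mulrC.
  have eqe w : w \in B -> e1 w = e2 w.
    by move=> wB; have := eqB w wB; rewrite !ffunE wB (disjointFl dAB wB).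
  have -> : glue A B d1 e2 g = glue A B d1 e1 g.
    by apply/ffunP => w; rewrite !ffunE; case: ifP => // _; case: ifP => // /eqe.
  have -> // : glue A B d2 e1 g = glue A B d2 e2 g.
  by apply/ffunP => w; rewrite !ffunE; case: ifP => // _; case: ifP => // /eqe.
rewrite rmorphB; apply/eqP; rewrite subr_eq0; apply/eqP.
case: (boolP (in_cube (glue A B d e g) && in_cube (glue A B d' e' g))) => [/andP[i1 i2]|ni].
  by rewrite swap_glue.
case: (boolP (in_cube (glue A B d e' g) && in_cube (glue A B d' e g))) => [/andP[i1 i2]|ni'].
  by rewrite [in RHS]swap_glue.
rewrite !rmorphM !kill_indet.
have kill_pair (x y : state N) : ~~ (in_cube x && in_cube y) ->
    (if in_cube x then p x else 0) * (if in_cube y then p y else 0) = 0.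
  by case: (in_cube x); case: (in_cube y); rewrite ?mulr0 ?mul0r.
by rewrite !kill_pair.
Qed.

End Quartics.

Lemma B4_quartic f : B4 k N f -> exists S1 S2 S3 a b c,
  [/\ is_partition3 S1 S2 S3, [/\ is_arc S1, is_arc S2 & is_arc S3] & f = quartic S1 S2 a b c].
Proof.
move=> [S1 [S2 [S3 [part arcs _ [a [b [c ->]]]]]]].
exists S1, S2, S3, a, b, c; split=> //.
by rewrite /quartic !big_cons !big_nil !mulr1 !mulrA.
Qed.

Lemma eq_between (d : nat -> bool) i j : (i <= j)%N ->
  (forall l, (i <= l < j)%N -> d l = d l.+1) -> d i = d j.
Proof.
move=> le_ij dd; apply/eqP; apply: contraT => neq.
have lt_ij : (i < j)%N by rewrite ltn_neqAle le_ij andbT; apply: contraNneq neq => ->.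
by have [l /dd->] := nat_change lt_ij neq; rewrite eqxx.
Qed.

Lemma is_arc_cyc (S : {set 'I_N}) (u : 'I_N) (l : nat) :
  (forall w : 'I_N, w \in S <-> exists2 i, (i < l)%N & w = cyc u i) -> is_arc S.
Proof.
move=> SE; exists u, l; apply/setP => v.
have iterE i : iter i (@ordS N) u = cyc u i.
  by elim: i => [|i IHi]; rewrite ?cyc0 // iterS IHi ordS_cyc.
rewrite inE; apply/idP/trajectP => [/SE[i lt_i ->]|[i lt_i ->]].
  by exists i => //; rewrite iterE.
by apply/SE; exists i => //; rewrite iterE.
Qed.

Lemma arc_segment t t' : (t' < N)%N -> is_arc [set w : 'I_N | (t < w <= t')%N]%SET.
Proof.
move=> lt_t'; have val_cyc_t i : (t.+1 + i < N)%N -> cyc (inord t.+1 : 'I_N) i = (t.+1 + i)%N :> nat.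
  move=> lt_ti; have lt_t := leq_ltn_trans (leq_addr i t.+1) lt_ti.
  by rewrite val_cyc inordK ?modn_small.
apply: (@is_arc_cyc _ (inord t.+1) (t' - t)) => w; rewrite inE.
split=> [/andP[lt_tw le_wt']|[i lt_i ->]].
  exists (w - t.+1)%N; first by clear -lt_tw le_wt'; lia.
  by apply: val_inj; rewrite /= val_cyc_t subnKC.
by rewrite val_cyc_t; clear -lt_i lt_t'; lia.
Qed.

Lemma arc_cosegment t t' : (t < t')%N -> (t' < N)%N ->
  is_arc [set w : 'I_N | (w <= t)%N || (t' < w)%N]%SET.
Proof.
move=> lt_tt' lt_t'.
have val_t i : cyc (inord t' : 'I_N) i = ((t' + i) %% N)%N :> nat by rewrite val_cyc inordK.
have rE i : cyc (cyc (inord t' : 'I_N) 1) i = cyc (inord t') i.+1.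
  by apply: val_inj; rewrite /= !val_cyc modnDml -addnA add1n.
(* The arc starts at the successor of t', which is the vertex 0 if t' is the last vertex. *)
apply: (@is_arc_cyc _ (cyc (inord t') 1) (N - t' + t)) => w; rewrite inE; split.
  have lt_w := ltn_ord w; move=> /orP[le_wt|lt_t'w].
    exists (w + N - t'.+1)%N; first by clear -le_wt lt_w lt_t'; lia.
    rewrite rE; apply: val_inj; rewrite /= val_t.
    have -> : (t' + (w + N - t'.+1).+1 = w + N)%N by clear -lt_t'; lia.
    by rewrite modnDr modn_small.
  exists (w - t'.+1)%N; first by clear -lt_t'w lt_w; lia.
  rewrite rE; apply: val_inj; rewrite /= val_t.
  have -> : (t' + (w - t'.+1).+1 = w)%N by clear -lt_t'w; lia.
  by rewrite modn_small.
move=> [i lt_i ->]; rewrite rE val_t.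
have [lt_iN|ge_iN] := ltnP (t' + i.+1) N; first by rewrite modn_small //; clear; lia.
by rewrite -(subnK ge_iN) modnDr modn_small; clear -lt_i lt_t' lt_tt' ge_iN; lia.
Qed.

(** Cutting the three edges gives three arcs. Across a flat edge the difference of two rows does not
    change, so on each arc a row equals a fixed row [z] or its flip. *)
Lemma B4_of_flat u t1 t2 t3 : (t1 < t2)%N -> (t2 < t3)%N -> (t3 < N)%N ->
    (forall l, (l < N)%N -> l \notin [:: t1; t2; t3] -> flat u l) ->
  exists S1 S2 z, B4 k N (quartic S1 S2 z z z) /\ all (in_cube S1 S2 z z z) u.
Proof.
move=> lt12 lt23 lt3 flat_u.
pose S1 : {set 'I_N} := [set w : 'I_N | (t1 < w <= t2)%N]%SET.
pose S2 : {set 'I_N} := [set w : 'I_N | (t2 < w <= t3)%N]%SET.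
pose S3 : {set 'I_N} := [set w : 'I_N | (w <= t1)%N || (t3 < w)%N]%SET.
pose z := head [ffun=> false] u.
have lt_2 := ltn_trans lt23 lt3; have lt_1 := ltn_trans lt12 lt_2.
exists S1, S2, z; split.
  exists S1, S2, S3; split; last by exists z, z, z; rewrite /quartic !big_cons !big_nil !mulr1 !mulrA.
  - split; first by apply/setP => w; rewrite !inE; clear -lt12 lt23; lia.
    + by apply/pred0P => w; rewrite /= !inE; clear -lt12 lt23; lia.
    + by apply/pred0P => w; rewrite /= !inE; clear -lt12 lt23; lia.
    + by apply/pred0P => w; rewrite /= !inE; clear -lt12 lt23; lia.
  - by split; [exact: arc_segment|exact: arc_segment|apply: arc_cosegment (ltn_trans lt12 lt23) lt3].
  split; apply/finset.set0Pn.
  - by exists (Ordinal lt_2); rewrite inE /= lt12 leqnn.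
  - by exists (Ordinal lt3); rewrite inE /= lt23 leqnn.
  - by exists (Ordinal lt_1); rewrite inE /= leqnn.
apply/allP => x xu; apply/mem_corners.
have zu : z \in u by rewrite /z; case: (u) xu => //= y s _; rewrite mem_head.
pose d l := bit x l (+) bit z l.
have d_flat l : (l < N)%N -> l \notin [:: t1; t2; t3] -> d l = d l.+1.
  move=> lt_l out; have [e fe] := flat_u l lt_l out.
  have := fe x xu; have := fe z zu; rewrite /d.
  by case: (bit x l) => /=; case: (bit z l) => /=; case: (bit x l.+1); case: (bit z l.+1) => /= <-.
have dE (w : 'I_N) e : d w = e -> e (+) z w = x w.
  by rewrite /d !bit_ord => <-; rewrite -addbA addbb addbF.
have between i j : (i <= j <= N)%N -> (forall l, (i <= l < j)%N -> l \notin [:: t1; t2; t3]) -> d i = d j.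
  move=> /andP[le_ij le_j] out; apply: eq_between => // l lt_l.
  by apply: d_flat; [case/andP: lt_l => _ /leq_trans; apply|exact: out].
(* The vertices t2, t3 and 0 represent the three arcs. *)
exists (d t2), (d t3), (d 0); apply/esym/glue_eq => w; rewrite flip_ifE ?inE.
- move=> /andP[lt_1w le_w2]; apply/dE/between; first by clear -le_w2 lt23 lt3; lia.
  by move=> l; rewrite !inE; clear -lt_1w le_w2 lt23; lia.
- move=> /andP[lt_2w le_w3]; apply/dE/between; first by clear -le_w3 lt23 lt3; lia.
  by move=> l; rewrite !inE; clear -lt12 lt_2w le_w3 lt23; lia.
have lt_w := ltn_ord w; move=> w1 w2.
have [le_w1|lt_3w] : (w <= t1)%N \/ (t3 < w)%N by clear -w1 w2 lt12 lt23; lia.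
  apply/dE/esym/between; first by clear -lt_w; lia.
  by move=> l; rewrite !inE; clear -le_w1 lt12 lt23; lia.
have <- : d N = d 0 by rewrite /d !bitN.
apply/dE/between; first by rewrite (ltnW lt_w) leqnn.
by move=> l; rewrite !inE; clear -lt_3w lt12 lt23; lia.
Qed.

(** With at most three nonflat edges the monomial would survive [kill] for some quartic, so its
    coefficient in F would be 0. *)
Lemma four_nonflat_msupp (F : mpoly_on k (state N)) m :
  (forall f, B4 k N f -> monomial_prime f F) -> m \in msupp F ->
  four_nonflat (seq_mnm m).
Proof.
move=> FP mF t1 t2 t3 lt12 lt23 lt3 flat_m.
have [S1 [S2 [z [B4z /(kill_coef F)]]]] := B4_of_flat lt12 lt23 lt3 flat_m.
have /monomial_prime_kill -> := FP _ B4z; rewrite mcoeff0 => /esym/eqP.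
by rewrite mcoeff_eq0 mF.
Qed.

End QuarticPrimes.

(** * The prime decomposition and radicality *)

Section Decomposition.
Import GRing.Theory.
Local Open Scope ring_scope.
Variables (k : fieldType) (n : nat).
Local Notation N := n.+1.

Lemma monomial_prime_is_prime (f : mpoly_on k (state N) * mpoly_on k (state N)) :
  B4 k N f -> is_prime_ideal (monomial_prime f).
Proof.
move=> /B4_quartic[S1 [S2 [S3 [a [b [c [_ _ ->]]]]]]].
suff -> : monomial_prime (quartic k S1 S2 a b c) =
    [set f | kill k (in_cube S1 S2 a b c) f = 0]%classic by exact: kernel_is_prime.
by apply/seteqP; split=> F /monomial_prime_kill.
Qed.

(** The forward inclusion is checked on generators. Conversely, F is a combination of differences of
    monomials in common toric fibres, and membership in all P_f makes those fibres connected. *)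
Lemma global_markov_decomposition : (0 < n)%N ->
  global_markov_ideal k N =
    (toric_ideal k N `&` \bigcap_(f in B4 k N) monomial_prime f)%classic.
Proof.
move=> n_gt0; apply/seteqP; split=> F.
  move=> glF; split; first exact: (ideal_gen_sub (@global_markov_toric k n)) glF.
  move=> f /B4_quartic[S1 [S2 [S3 [a [b [c [part arcs ->]]]]]]].
  apply/monomial_prime_kill.
  by apply: ideal_gen_sub glF => g; apply: global_markov_kill part arcs _.
move=> [toricF quarticF].
apply: (ideal_of_fibers (mu := @mnm_fiber n)) => [|m m' mF m'F eq_mm'].
  transitivity (toric_rmorph k n F); last exact: toricF.
  rewrite [in RHS](mpolyE F) rmorph_sum; apply: eq_bigr => m _.
  by rewrite -mul_mpolyC -[in RHS]mul_mpolyC rmorphM toric_mnm /= mmapC.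
have := conn_global_markov k (fiber_connected (fiber_Eeq n_gt0 eq_mm') (four_nonflat_msupp quarticF m'F)).
by rewrite !mpolyX_seq !seq_mnmK.
Qed.

Lemma global_markov_radical : (0 < n)%N -> is_radical (global_markov_ideal k N).
Proof.
move=> n_gt0 F m; rewrite global_markov_decomposition // => -[toricF quarticF]; split.
  exact: (@kernel_is_radical _ _ (toric_rmorph k n)) toricF.
move=> f B4f; have := quarticF f B4f; have [S1 [S2 [S3 [a [b [c [_ _ ->]]]]]]] := B4_quartic B4f.
by move=> /monomial_prime_kill/kernel_is_radical/monomial_prime_kill.
Qed.

End Decomposition.

Theorem theorem5p6 (k : fieldType) (N : nat) (hN : (4 <= N)%N) :
  [/\ is_radical (global_markov_ideal k N),
      is_prime_ideal (toric_ideal k N),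
      (forall f, B4 k N f -> is_prime_ideal (monomial_prime f)) &
      global_markov_ideal k N =
        (toric_ideal k N `&` \bigcap_(f in B4 k N) monomial_prime f)%classic].
Proof.
case: N hN => [//|n] hN; have n_gt0 : (0 < n)%N by case: n hN.
split.
- exact: global_markov_radical.
- exact: (kernel_is_prime (toric_rmorph k n)).
- exact: monomial_prime_is_prime.
- exact: global_markov_decomposition.
Qed.
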